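(* There exist absolute constants $C_1,C_2>0$ such that the following holds. For every $0<\beta<\frac14$ there exist $\eta,n_0,\gamma>0$ such that for every $n\ge n_0$: if $G$ is a $(p,\eta)$-upper-uniform graph on $n$ vertices with $e(G)\ge (1-\beta/2)p\binom n2$ for some $0<p=p(n)\le 1$, then for any integer $t$ with $\frac{C_1}{\log(1/\beta)}\cdot\log n\le t\le (1-C_2\beta)n$, every subgraph $G'$ of $G$ with $$e(G')\ge \left(g^\gamma(t,n)+\beta\right)e(G)$$ edges contains a cycle of length $t$.
   Context: Graphs are finite and simple; $e(G)$ is the number of edges of $G$; $\log$ is the natural logarithm; the length of a cycle or path is its number of edges; $C_t$ is the cycle of length $t$ and $P_t$ is the path of length $t$ (with $t$ edges). Upper-uniformity: let $G$ be a graph on $n$ vertices, $0<\eta\le 1$ and $0<p\le 1$. $G$ is $(p,\eta)$-upper-uniform if for all disjoint $U,W\subseteq V(G)$ with $|U|,|W|\ge \eta n$, the number $e_G(U,W)$ of edges between $U$ and $W$ satisfies $e_G(U,W)\le (1+\eta)p|U||W|$. The function $g^\gamma(t,n)$, for a parameter $\gamma>0$ (cases read in the order listed): if $t$ is odd, $g^\gamma(t,n)$ is defined by $$g^\gamma(t,n)\binom n2=\begin{cases}\binom{t-1}2+\binom{n-t+2}2+1,& t\ge \frac12(n+3),\\ \lfloor \frac14n^2\rfloor+1,& t<\frac12(n+3);\end{cases}$$ if $t$ is even, $$g^\gamma(t,n)\binom n2=\begin{cases}\binom{t-1}2+\binom{n-t+2}2+1,& t\ge \frac12(n+3),\\ \lfloor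 \frac12n(t-1)\rfloor+1,& \gamma n\le t<\frac12(n+3),\\ 0,& t<\gamma n.\end{cases}$$ *)

(* Defs.v *)
From HB Require Import structures.
From mathcomp Require Import all_boot all_order all_algebra.
From mathcomp Require Import reals exp.

Set Implicit Arguments.
Unset Strict Implicit.
Unset Printing Implicit Defensive.

Import Order.TTheory GRing.Theory Num.Theory.
Local Open Scope ring_scope.

(* Finite simple graphs with vertex set the whole of T. *)
Record sgraph (T : finType) := SGraph {
  adj :> rel T;
  adj_sym : symmetric adj;
  adj_irrefl : irreflexive adj
}.

Definition edges (T : finType) (G : sgraph T) : {set {set T}} :=
  [set [set z.1; z.2] | z : T * T & G z.1 z.2].

Definition nb_edges (T : finType) (G : sgraph T) : nat := #|edges G|.

(* Counts ordered pairs; for disjoint U and W this is the number of edges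
   between U and W. *)
Definition edges_between (T : finType) (G : sgraph T) (U W : {set T}) : nat :=
  #|[set z : T * T | [&& z.1 \in U, z.2 \in W & G z.1 z.2]]|.

(* Subgraphs are taken on the same vertex set: vertices missing from a subgraph
   are kept as isolated vertices, which affects neither its number of edges nor
   its cycles. *)
Definition subgraph (T : finType) (H G : sgraph T) : Prop := subrel H G.

(* ucycle accepts sequences of size 0 and 2 (the latter for any edge), hence the
   bound on t. *)
Definition has_cycle (T : finType) (G : sgraph T) (t : nat) : Prop :=
  (3 <= t)%N /\ exists2 c : seq T, size c = t & ucycle G c.

Definition upper_uniform (R : realType) (T : finType) (p eta : R)
    (G : sgraph T) : Prop :=
  forall U W : {set T}, [disjoint U & W] ->
    eta * #|T|%:R <= #|U|%:R -> eta * #|T|%:R <= #|W|%:R ->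
    (edges_between G U W)%:R <= (1 + eta) * p * #|U|%:R * #|W|%:R.

(* The value of g^gamma(t, n) * 'C(n, 2). The condition t >= (n + 3) / 2 is
   cleared of denominators, and n - t + 2 is written n + 2 - t so that the
   truncated subtraction is exact for t <= n + 2. *)
Definition g_edges (R : realType) (gamma : R) (t n : nat) : nat :=
  if (n + 3 <= 2 * t)%N then ('C(t - 1, 2) + 'C(n + 2 - t, 2) + 1)%N
  else if odd t then (n ^ 2 %/ 4 + 1)%N
  else if gamma * n%:R <= t%:R then ((n * (t - 1)) %/ 2 + 1)%N
  else 0%N.

(* Meaningful for n >= 2. *)
Definition g (R : realType) (gamma : R) (t n : nat) : R :=
  (g_edges gamma t n)%:R / 'C(n, 2)%:R.

(* Main.v *)
(* A pair (A, B) of vertex sets is m-joined if any two subsets of A and B of size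
   at least m span an edge.  Refining along pairs without edges, with the volume
   of the edgeless pairs of blocks as increasing potential, gives boundedly many
   blocks of equal size such that nearly all pairs of blocks are edgeless or
   m-joined, with m a small fraction of the block size; by upper-uniformity the
   non-edgeless m-joined pairs then have nearly the edge density of G' relative
   to G.  Koenig's theorem in the bipartite double cover of this reduced graph
   provides one component (nonbipartite if t is odd) with a matching of the double
   cover that covers slightly more than t vertices of the blow-up: a vertex cover
   that is too small would force too few edges.

   In each matched pair of half-blocks a depth-first search finds an almost
   spanning path; a subpath of any prescribed odd length has, after a shift, a
   neighbour of each end in a reserved expander, where that end grows a tree of
   branching about 1/beta and of depth about log n / log (1/beta), with at least m
   leaves.  Leaf sets of size m are connected along walks of the reduced graph
   through reserved vertices, so all lengths are controlled exactly. *)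
Require Import Defs.
From HB Require Import structures.
From mathcomp Require Import all_boot all_order all_algebra.
From mathcomp Require Import reals exp.
From mathcomp Require Import zify ring lra.

Set Implicit Arguments.
Unset Strict Implicit.
Unset Printing Implicit Defensive.

Import Order.TTheory GRing.Theory Num.Theory.
Local Open Scope nat_scope.

(** * Joined pairs, long paths and expanders *)

(** Upper-uniformity bounds densities only from above and [p] may tend to 0, so no counting or
    embedding lemma is at hand. All embedding therefore uses the qualitative property [joined];
    densities serve only to show that many pairs of blocks are not edgeless.

    Since [t] may be as small as order log n / log (1/beta), the depth of the two trees is the only
    unbounded overhead a cycle can afford. Branching D close to 1/beta is possible because m is
    about s / N with N of order D^2: the reserves, of order D * m, take a fraction of order beta of
    a block. A single matched pair handles every t up to about s, and all pairs together the larger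
    ones.

    The thresholds come from one count: a cover of the double cover of a component of order c, with
    a vertices taken on both sides and b on one, allows at most 2ac - a^2 + b^2 arcs. Comparison
    with Qc gives the density t/n for short even t; comparison with Q^2 + (k - Q)^2, for k blocks,
    gives the long range, and its minimum at Q = k/2 gives the density 1/2 for short odd t. *)

Definition joined (T : finType) (G : sgraph T) (m : nat) (A B : {set T}) : bool :=
  [forall X : {set T}, forall Y : {set T},
    [&& X \subset A, Y \subset B, m <= #|X| & m <= #|Y|] ==>
    (0 < edges_between G X Y)].

Lemma edges_betweenP (T : finType) (G : sgraph T) (U W : {set T}) :
  reflect (exists x y, [/\ x \in U, y \in W & G x y]) (0 < edges_between G U W).
Proof.
apply: (iffP (@card_gt0P _ _)) => [[[x y]]|[x [y [xU yW xy]]]].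
  by rewrite inE /= => /and3P[]; exists x, y.
by exists (x, y); rewrite inE /= xU yW.
Qed.

Lemma joinedP (T : finType) (G : sgraph T) (m : nat) (A B : {set T}) :
  reflect (forall X Y : {set T}, X \subset A -> Y \subset B ->
             m <= #|X| -> m <= #|Y| -> exists x y, [/\ x \in X, y \in Y & G x y])
          (joined G m A B).
Proof.
apply: (iffP forallP) => [H X Y XA YB mX mY | H X].
  by apply/edges_betweenP; move/forallP: (H X) => /(_ Y); rewrite XA YB mX mY.
apply/forallP => Y; apply/implyP => /and4P[XA YB mX mY].
by apply/edges_betweenP; apply: H.
Qed.

Lemma joined_sym (T : finType) (G : sgraph T) (m : nat) (A B : {set T}) :
  joined G m A B -> joined G m B A.
Proof.
move=> /joinedP H; apply/joinedP => X Y XB YA mX mY.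
have [x [y [xY yX xy]]] := H _ _ YA XB mY mX.
by exists y, x; split=> //; rewrite adj_sym.
Qed.

Lemma joinedS (T : finType) (G : sgraph T) (m : nat) (A B A' B' : {set T}) :
  A' \subset A -> B' \subset B -> joined G m A B -> joined G m A' B'.
Proof.
move=> AA BB /joinedP H; apply/joinedP => X Y XA YB.
by apply: H; [apply: subset_trans AA | apply: subset_trans BB].
Qed.

Definition nbr (T : finType) (G : sgraph T) (U : {set T}) : {set T} :=
  [set y | [exists x in U, G x y]].

Lemma nbrP (T : finType) (G : sgraph T) (U : {set T}) (y : T) :
  reflect (exists2 x, x \in U & G x y) (y \in nbr G U).
Proof. by rewrite inE; apply: exists_inP. Qed.

Lemma nbrU (T : finType) (G : sgraph T) (U W : {set T}) :
  nbr G (U :|: W) = nbr G U :|: nbr G W.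
Proof.
apply/setP => y; rewrite in_setU; apply/nbrP/orP => [[x]|].
  by rewrite in_setU => /orP[xU|xW] xy; [left|right]; apply/nbrP; exists x.
by case=> /nbrP[x xU xy]; exists x; rewrite // in_setU xU ?orbT.
Qed.

Lemma joined_nbr (T : finType) (G : sgraph T) (m : nat) (A B X Y : {set T}) :
  joined G m A B -> X \subset A -> Y \subset B -> m <= #|X| -> 0 < m ->
  #|Y :\: nbr G X| < m.
Proof.
move=> /joinedP H XA YB mX m0; rewrite ltnNge; apply/negP => mY.
have YB' : Y :\: nbr G X \subset B by rewrite (subset_trans _ YB) ?subsetDl.
have [x [y [xX]]] := H _ _ XA YB' mX mY.
by rewrite in_setD => /andP[/nbrP yN _] xy; apply: yN; exists x.
Qed.

Definition bip (T : finType) (G : sgraph T) (X Y : {set T}) : rel T :=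
  fun x y => G x y && ((x \in X) && (y \in Y) || (x \in Y) && (y \in X)).

Lemma bipC (T : finType) (G : sgraph T) (X Y : {set T}) : bip G X Y =2 bip G Y X.
Proof. by move=> x y; rewrite /bip orbC. Qed.

Lemma bip_sym (T : finType) (G : sgraph T) (X Y : {set T}) : symmetric (bip G X Y).
Proof.
move=> x y; rewrite /bip adj_sym.
by case: (G y x) (x \in X) (y \in X) (x \in Y) (y \in Y) => [] [] [] [] [].
Qed.

Lemma bip_path_count (T : finType) (G : sgraph T) (X Y : {set T}) (p : seq T) :
  [disjoint X & Y] -> sorted (bip G X Y) p ->
  count (mem X) p <= count (mem Y) p + 1.
Proof.
move=> dXY; case: p => [//|x p] /= px.
have dE z : z \in X -> z \notin Y by move=> zX; rewrite (disjointFr dXY zX).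
(* The induction has to know the side of the starting vertex: an excess of one vertex in [X] occurs
   only for a path that starts in [X]. *)
suff : count (mem X) (x :: p) <= count (mem Y) (x :: p) + (x \in X).
  by rewrite /=; have := leq_b1 (x \in X); lia.
elim: p x px => [|y p IH] x /=; first by have := leq_b1 (x \in X); lia.
move=> /andP[/andP[_ xy] /IH] /=.
case/orP: xy => /andP[xX yY].
  have yX : y \notin X by apply/negP => /dE; rewrite yY.
  have xY := dE _ xX.
  by rewrite xX (negbTE xY) (negbTE yX) yY; lia.
have xX' : x \notin X by apply/negP => /dE; rewrite xX.
have yY' := dE _ yY.
by rewrite xX yY (negbTE yY') (negbTE xX'); lia.
Qed.

Lemma count_disjoint (T : finType) (X Y : {set T}) (p : seq T) :
  [disjoint X & Y] -> count (mem X) p + count (mem Y) p <= size p.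
Proof.
move=> dXY; elim: p => //= x p IH.
case xX: (x \in X); last by have := leq_b1 (x \in Y); lia.
by rewrite (disjointFr dXY xX); lia.
Qed.

Lemma card_split_seq (T : finType) (X D U : {set T}) (p : seq T) :
  (forall x, x \in X -> [|| x \in D, x \in U | x \in p]) ->
  #|X| <= #|D :&: X| + #|U :&: X| + count (mem X) p.
Proof.
move=> cov.
have sub : X \subset (D :&: X) :|: (U :&: X) :|: [set x in filter (mem X) p].
  apply/subsetP => x xX; rewrite !inE mem_filter /= xX !andbT -orbA; exact: cov.
apply: leq_trans (subset_leq_card sub) _.
apply: leq_trans (leq_card_setU _ _) _; rewrite leq_add ?leq_card_setU //.
by rewrite -size_filter cardsE card_size.
Qed.

Lemma setU1I_notin (T : finType) (X D : {set T}) (x : T) :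
  x \notin X -> (x |: D) :&: X \subset D :&: X.
Proof.
move=> xX; apply/subsetP => y; rewrite !in_setI in_setU1 => /andP[/predU1P[->|->//]].
by rewrite (negbTE xX).
Qed.

Lemma exists_long_path (T : finType) (G : sgraph T) (X Y : {set T}) (m h : nat) :
  [disjoint X & Y] -> #|X| = h -> #|Y| = h -> 0 < m -> joined G m X Y ->
  exists p, [/\ sorted (bip G X Y) p, uniq p, {subset p <= X :|: Y} &
               2 * h <= size p + 4 * m + 1].
Proof.
move=> dXY hX hY m0 jXY.
have jYX := joined_sym jXY.
(* A depth-first search state: a stack [p] and a set [D] of abandoned vertices
   with no edge to the vertices [U] still to be visited. *)
pose U (D : {set T}) (p : seq T) := (X :|: Y) :\: (D :|: [set x in p]).
(* An unvisited vertex weighs two and a stacked vertex one, so that pushing and popping both lower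
   the measure. *)
suff H N : forall (D : {set T}) p, 2 * #|U D p| + size p < N ->
    uniq p -> {subset p <= X :|: Y} -> sorted (bip G X Y) p ->
    (forall x, x \in p -> x \notin D) ->
    D \subset X :|: Y ->
    (forall x y, x \in D -> y \in U D p -> ~~ bip G X Y x y) ->
    #|D :&: X| < m -> #|D :&: Y| < m ->
    exists p, [/\ sorted (bip G X Y) p, uniq p, {subset p <= X :|: Y} &
                2 * h <= size p + 4 * m + 1].
  apply: (H (2 * #|U set0 [::]| + 1)%N.+1 set0 [::]) => //=.
  - by rewrite ltnS addn0 addn1 leqnSn.
  - by rewrite sub0set.
  - by move=> x y; rewrite inE.
  - by rewrite set0I cards0.
  - by rewrite set0I cards0.
elim: N => // N IH D p ltN up pXY sp pD DXY noe DX DY.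
have covX x : x \in X -> [|| x \in D, x \in U D p | x \in p].
  by move=> xX; rewrite !inE xX; case: (x \in D); case: (x \in p).
have covY x : x \in Y -> [|| x \in D, x \in U D p | x \in p].
  by move=> xY; rewrite !inE xY orbT; case: (x \in D); case: (x \in p).
have cX := card_split_seq covX; have cY := card_split_seq covY.
have cXY := count_disjoint p dXY.
have bX := bip_path_count dXY sp.
have bY : count (mem Y) p <= count (mem X) p + 1.
  apply: (@bip_path_count _ G); first by rewrite disjoint_sym.
  by rewrite (eq_sorted (bipC G Y X)).
have push u : u \in U D p -> (sorted (bip G X Y) (u :: p)) ->
    exists p, [/\ sorted (bip G X Y) p, uniq p, {subset p <= X :|: Y} &
                2 * h <= size p + 4 * m + 1].
  move=> uU su.
  have UE : U D (u :: p) = U D p :\ u.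
    by apply/setP => x; rewrite !inE; case: (x == u); rewrite ?orbT ?andbF //= ?andbT.
  move: (uU); rewrite !inE negb_or => /andP[/andP[uD up'] uXY].
  apply: (IH D (u :: p)) => //=.
  - by rewrite UE; move: ltN; rewrite (cardsD1 u (U D p)) uU; clear; lia.
  - by rewrite up'.
  - by move=> x; rewrite inE => /predU1P[->|/pXY//]; rewrite inE.
  - by move=> x; rewrite inE => /predU1P[->//|/pD].
  - by move=> x y xD; rewrite UE in_setD1 => /andP[_]; apply: noe.
case: (set_0Vmem (U D p)) => [U0|[u uU]].
  exists p; split=> //.
  by move: cX cY; move: cXY DX DY bX bY; rewrite U0 !set0I cards0 hX hY; clear; lia.
case: p => [|x p] in sp ltN up pXY pD noe covX covY cX cY cXY bX bY push uU *.
  exact: (push u).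
case: (boolP [exists u in U D (x :: p), bip G X Y u x]) => [/exists_inP[v vU vx]|].
  by apply: (push v) => //=; rewrite vx.
move=> /exists_inPn nox.
have xp : x \in x :: p by rewrite mem_head.
have xD := pD _ xp.
have UE : U (x |: D) p = U D (x :: p).
  by apply/setP => y; rewrite !inE; case: (y == x); rewrite ?orbT //= ?orbF.
have noe' y z : y \in x |: D -> z \in U D (x :: p) -> ~~ bip G X Y y z.
  rewrite in_setU1 => /predU1P[->|yD]; last exact: noe.
  by rewrite bip_sym; apply: nox.
(* The search stops when abandoning [x] would bring [m] abandoned vertices to a side [A]. Then fewer
   than [m] vertices of the other side [B] are unvisited and fewer than [m] abandoned, so the stack
   holds more than [h - 2 * m] vertices of [B] and, by alternation, almost as many of [A]. *)
have fin (A B : {set T}) : [disjoint A & B] -> joined G m A B -> #|A| = h -> #|B| = h ->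
     #|D :&: A| < m -> #|D :&: B| < m -> A \subset X :|: Y ->
     (forall y z, G y z -> y \in A -> z \in B -> bip G X Y y z) ->
     #|B| <= #|D :&: B| + #|U D (x :: p) :&: B| + count (mem B) (x :: p) ->
     count (mem B) (x :: p) <= count (mem A) (x :: p) + 1 ->
     count (mem A) (x :: p) + count (mem B) (x :: p) <= size (x :: p) ->
     x \in A -> m <= #|(x |: D) :&: A| ->
     2 * h <= size (x :: p) + 4 * m + 1.
  move=> dAB /joinedP jAB hA hB DA DB sA bE cB bB cAB xA mD.
  case: (ltnP #|U D (x :: p) :&: B| m) => [UB|UB].
    by move: cB bB cAB DB UB; rewrite hB; clear; lia.
  have [y [z [yA zB yz]]] := jAB _ _ (subsetIr (x |: D) A) (subsetIr _ B) mD UB.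
  move: yA zB; rewrite in_setI => /andP[yD yA]; rewrite in_setI => /andP[zU zB].
  by move: (noe' _ _ yD zU); rewrite bE.
case: (leqP m #|(x |: D) :&: X|) => [mX|mX].
  exists (x :: p); split=> //.
  have xX : x \in X.
    apply: contraLR mX => xN; rewrite -ltnNge; apply: leq_ltn_trans DX.
    exact: (subset_leq_card (setU1I_notin D xN)).
  apply: (fin X Y) => //; first exact: subsetUl.
    by move=> y z yz yX zY; rewrite /bip yz yX zY.
case: (leqP m #|(x |: D) :&: Y|) => [mY|mY].
  exists (x :: p); split=> //.
  have xY : x \in Y.
    apply: contraLR mY => xN; rewrite -ltnNge; apply: leq_ltn_trans DY.
    exact: (subset_leq_card (setU1I_notin D xN)).
  apply: (fin Y X) => //; first by rewrite disjoint_sym.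
  - exact: subsetUr.
  - by move=> y z yz yY zX; rewrite /bip yz yY zX orbT.
  - by rewrite addnC.
apply: (IH (x |: D) p) => //.
- by rewrite UE; move: ltN => /=; clear; lia.
- by move: up => /andP[].
- by move=> y yp; apply: pXY; rewrite inE yp orbT.
- exact: path_sorted sp.
- move=> y yp; rewrite !inE negb_or pD ?inE ?yp ?orbT // andbT.
  by apply: contraTneq yp => ->; case/andP: up.
- by rewrite subUset sub1set DXY pXY.
- by rewrite UE; apply: noe'.
Qed.

Lemma subset_card_eq (T : finType) (A : {set T}) (k : nat) :
  k <= #|A| -> exists2 B : {set T}, B \subset A & #|B| = k.
Proof.
move=> kA; have : 0 < #|[set B : {set T} | B \subset A & #|B| == k]|.
  by rewrite cards_draws bin_gt0.
by case/card_gt0P => B; rewrite inE => /andP[BA /eqP Bk]; exists B.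
Qed.

(** The length is exact and [Q] confines the vertices, so that concatenation asks only for disjoint
    regions. *)
Definition linked (T : finType) (G : sgraph T) (Q : {set T}) (x y : T) (L : nat) : Prop :=
  exists p, [/\ path G x p, last x p = y, size p = L, uniq (x :: p) &
                {subset x :: p <= Q}].

Lemma linked_refl (T : finType) (G : sgraph T) (x : T) : linked G [set x] x x 0.
Proof. by exists [::]; split=> // y; rewrite !inE. Qed.

Lemma linkedS (T : finType) (G : sgraph T) (Q Q' : {set T}) (x y : T) (L : nat) :
  Q \subset Q' -> linked G Q x y L -> linked G Q' x y L.
Proof.
move=> /subsetP QQ [p [pp lp sp up pQ]]; exists p; split=> // z zp.
by apply: QQ; apply: pQ.
Qed.

Lemma linked_sym (T : finType) (G : sgraph T) (Q : {set T}) (x y : T) (L : nat) :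
  linked G Q x y L -> linked G Q y x L.
Proof.
move=> [p [pp lp sp up pQ]].
have rE : y :: rev (belast x p) = rev (x :: p) by rewrite (lastI x p) rev_rcons lp.
exists (rev (belast x p)); split.
- rewrite -lp rev_path (eq_path (e' := G)) // => a b; exact: adj_sym.
- by case: p {pp sp up pQ rE} lp => [/= ->|z p _] //=; rewrite rev_cons last_rcons.
- by rewrite size_rev size_belast.
- by rewrite rE rev_uniq.
- by move=> z; rewrite rE mem_rev => /pQ.
Qed.

Lemma linked_cat (T : finType) (G : sgraph T) (Q Q' : {set T}) (x y x' y' : T) (L L' : nat) :
  [disjoint Q & Q'] -> linked G Q x y L -> linked G Q' x' y' L' -> G y x' ->
  linked G (Q :|: Q') x y' (L + L' + 1).
Proof.
move=> dQ [p [pp lp sp up pQ]] [p' [pp' lp' sp' up' pQ']] yx.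
exists (p ++ x' :: p'); split.
- by rewrite cat_path pp lp /= yx.
- by rewrite last_cat /= lp'.
- by rewrite size_cat /= sp sp' addnS addn1.
- rewrite -cat_cons cat_uniq up up' andbT andTb; apply/negP => /hasP[z zp' zp].
  by have := disjointFr dQ (pQ _ zp); rewrite pQ'.
- move=> z; rewrite -cat_cons mem_cat in_setU => /orP[/pQ->//|/pQ'->].
  by rewrite orbT.
Qed.

Lemma linked_nth (T : finType) (G : sgraph T) (p : seq T) (x0 : T) (i l : nat) :
  sorted G p -> uniq p -> i + l < size p ->
  linked G [set x in p] (nth x0 p i) (nth x0 p (i + l)) l.
Proof.
move=> sp up il.
have dE : drop i p = nth x0 p i :: drop i.+1 p by rewrite -drop_nth //; lia.
exists (take l (drop i.+1 p)).
have tE : nth x0 p i :: take l (drop i.+1 p) = take l.+1 (drop i p) by rewrite dE.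
have sz : size (take l (drop i.+1 p)) = l by rewrite size_takel // size_drop; lia.
split=> //.
- have : sorted G (take l.+1 (drop i p)) by apply/take_sorted/drop_sorted.
  by rewrite -tE.
- rewrite (last_nth x0) tE sz nth_take // nth_drop //.
- by rewrite tE take_uniq // drop_uniq.
- by move=> z; rewrite tE inE => /mem_take/mem_drop.
Qed.

Lemma joined_clean (T : finType) (G : sgraph T) (X Y : {set T}) (m D : nat) :
  0 < m -> joined G m X Y -> (2 * D + 2) * m <= #|X| -> (2 * D + 2) * m <= #|Y| ->
  exists X' Y' : {set T}, [/\ X' \subset X, Y' \subset Y,
    #|X| < #|X'| + m, #|Y| < #|Y'| + m &
    (forall U : {set T}, U \subset X' -> #|U| <= m -> D * #|U| <= #|nbr G U :&: Y'|) /\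
    (forall U : {set T}, U \subset Y' -> #|U| <= m -> D * #|U| <= #|nbr G U :&: X'|)].
Proof.
move=> m0 jXY sX sY; have jYX := joined_sym jXY.
(* Remove a largest pair (A, B) of small sets that expand badly: a badly
   expanding set of remaining vertices could be added to it. *)
pose ok (X Y A B : {set T}) := [&& A \subset X, B \subset Y, #|A| < m, #|B| < m,
  #|nbr G A :&: (Y :\: B)| <= D * #|A| & #|nbr G B :&: (X :\: A)| <= D * #|B|].
have okC X1 Y1 A B : ok X1 Y1 A B -> ok Y1 X1 B A.
  by move=> /and5P[? ? ? ? /andP[? ?]]; apply/and5P; split=> //; apply/andP.
have step (X1 Y1 A B U : {set T}) : joined G m X1 Y1 -> (2 * D + 2) * m <= #|Y1| ->
    ok X1 Y1 A B -> U \subset X1 :\: A -> #|U| <= m ->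
    #|nbr G U :&: (Y1 :\: B)| < D * #|U| -> ok X1 Y1 (A :|: U) B.
  move=> j1 s1 /and5P[AX BY Am Bm /andP[NA NB]] UX Um NU.
  have dAU : #|A :|: U| = #|A| + #|U|.
    apply/eqP; rewrite (leq_card_setU A U).2 disjoint_sym.
    by apply: disjointWl UX _; rewrite -setI_eq0 setDE setIAC -setIA setICr setI0.
  have NAU : #|nbr G (A :|: U) :&: (Y1 :\: B)| <= D * #|A :|: U|.
    rewrite nbrU setIUl dAU mulnDr; apply: leq_trans (leq_card_setU _ _) _.
    by rewrite leq_add // ltnW.
  have AUX : A :|: U \subset X1.
    by rewrite subUset AX; apply: subset_trans UX (subsetDl _ _).
  have NB' : #|nbr G B :&: (X1 :\: (A :|: U))| <= D * #|B|.
    apply: leq_trans NB; apply: subset_leq_card; apply: setIS; apply: setDS.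
    exact: subsetUl.
  rewrite /ok AUX BY Bm NAU NB' !andbT /=.
  (* With [m] vertices or more, [A :|: U] would reach all but fewer than [m] vertices of [Y1]; yet
     it reaches at most [2 * D * m] outside [B], and [B] has fewer than [m]. This is the source of
     [(2 * D + 2) * m]. *)
  rewrite ltnNge; apply/negP => mAU.
  have Yn := joined_nbr j1 AUX (subxx Y1) mAU m0.
  have : #|Y1| <= #|Y1 :\: nbr G (A :|: U)| + #|nbr G (A :|: U) :&: (Y1 :\: B)| + #|B|.
    apply: leq_trans (subset_leq_card (_ : _ \subset
       (Y1 :\: nbr G (A :|: U)) :|: (nbr G (A :|: U) :&: (Y1 :\: B)) :|: B)) _.
      apply/subsetP => y yY; rewrite !(in_setU, in_setI, in_setD) yY.
      by case: (y \in B) (y \in nbr G _) => [] [].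
    apply: leq_trans (leq_card_setU _ _) _.
    by rewrite leq_add // leq_card_setU.
  have Um' : D * (#|A| + #|U|) <= D * (2 * m) by rewrite leq_mul2l; apply/orP; right; lia.
  move: NAU Yn s1 Bm Um'; rewrite dAU; clear; nia.
have ok0 : ok X Y set0 set0.
  have n0 : nbr G set0 = set0.
    by apply/setP => y; rewrite in_set0; apply/nbrP => -[x]; rewrite in_set0.
  by rewrite /ok !sub0set cards0 m0 n0 !set0I cards0.
case: (@arg_maxnP _ ((set0, set0) : {set T} * {set T})
   (fun AB => ok X Y AB.1 AB.2) (fun AB => #|AB.1| + #|AB.2|) ok0) => -[A B] /= okAB mx.
have szD (X1 A1 : {set T}) : A1 \subset X1 -> #|A1| < m -> #|X1| < #|X1 :\: A1| + m.
  by move=> /setIidPr AX A1m; move: (cardsID A1 X1); rewrite AX; lia.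
have [AX BY Am Bm _] := and5P okAB.
exists (X :\: A), (Y :\: B); split; rewrite ?subsetDl ?szD //; split=> U UX Um.
  rewrite leqNgt; apply/negP => NU.
  have := mx (A :|: U, B) (step _ _ _ _ _ jXY sY okAB UX Um NU) => /=.
  have := cardsU A U; rewrite (_ : A :&: U = set0) ?cards0.
    by move: NU; case: (posnP #|U|) => [->|]; rewrite ?muln0 //; clear; lia.
  apply/setP => x; rewrite !inE; apply/negP => /andP[xA /(subsetP UX)].
  by rewrite inE xA.
rewrite leqNgt; apply/negP => NU.
have := mx (A, B :|: U) (okC _ _ _ _ (step _ _ _ _ _ jYX sX (okC _ _ _ _ okAB) UX Um NU)) => /=.
have := cardsU B U; rewrite (_ : B :&: U = set0) ?cards0.
  by move: NU; case: (posnP #|U|) => [->|]; rewrite ?muln0 //; clear; lia.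
apply/setP => x; rewrite !inE; apply/negP => /andP[xA /(subsetP UX)].
by rewrite inE xA.
Qed.

(** Layers at least double, so the tree [F] grown so far has at most [2 * q ^ d] vertices; the
    factor [q + 2] pays for avoiding all of them and still makes the next layer [q] times larger.
    The hypothesis on [q ^ d.-1] concerns the last layer that has to expand. *)
Lemma expander_layer (T : finType) (G : sgraph T) (X Y : {set T}) (m q d : nat) (z : T) :
  2 <= q -> q ^ d.-1 <= m ->
  (forall U : {set T}, U \subset X -> #|U| <= m -> (q + 2) * #|U| <= #|nbr G U :&: Y|) ->
  (forall U : {set T}, U \subset Y -> #|U| <= m -> (q + 2) * #|U| <= #|nbr G U :&: X|) ->
  z \in X ->
  exists S : {set T}, [/\ S \subset (if odd d then Y else X), #|S| = q ^ d &
    forall v, v \in S -> linked G (X :|: Y) z v d].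
Proof.
move=> q2 qm eX eY zX.
suff [S [F [/andP[SF FXY] SX cS cF SL]]] : exists S F : {set T}, [/\ (S \subset F) && (F \subset X :|: Y),
    S \subset (if odd d then Y else X), #|S| = q ^ d, #|F| <= 2 * q ^ d &
    forall v, v \in S -> linked G F z v d].
  by exists S; split=> // v /SL; apply: linkedS.
elim: d qm => [|d IH] qm.
  exists [set z], [set z]; rewrite subxx !sub1set in_setU zX cards1; split=> //.
  by move=> v /set1P->; apply: linked_refl.
have qd : q ^ d <= m by [].
have [|S [F [/andP[SF FXY] SX cS cF SL]]] := IH.
  by case: d qm {IH qd} => // d qm; apply: leq_trans qm; rewrite /= leq_pexp2l //; lia.
pose Z := if odd d.+1 then Y else X.
have ZXY : Z \subset X :|: Y by rewrite /Z; case: ifP; rewrite ?subsetUl ?subsetUr.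
have big : (q + 2) * q ^ d <= #|nbr G S :&: Z|.
  by rewrite -cS /Z /=; case: (odd d) SX => SX /=; [apply: eY | apply: eX]; rewrite // cS.
have /subset_card_eq[S' S'N cS'] : q ^ d.+1 <= #|(nbr G S :&: Z) :\: F|.
  have := cardsID F (nbr G S :&: Z); have := subset_leq_card (subsetIr (nbr G S :&: Z) F).
  move: big cF; rewrite expnS mulnDl; by clear; move: (q ^ d); lia.
exists S', (F :|: S'); split=> //.
- rewrite subsetUr subUset FXY; apply: subset_trans S'N _.
  by apply: subset_trans (subsetDl _ _) _; apply: subset_trans (subsetIr _ _) ZXY.
- by apply: subset_trans S'N _; apply: subset_trans (subsetDl _ _) (subsetIr _ _).
- have : #|F :|: S'| <= #|F| + #|S'| by apply: leq_card_setU.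
  rewrite cS'.
  by move: cF (leq_mul q2 (leqnn (q ^ d))); rewrite expnS; clear; move: (q ^ d); lia.
move=> v vS'; have := subsetP S'N _ vS'; rewrite !in_setD in_setI => /andP[vF /andP[/nbrP[u uS uv] _]].
have := linked_cat _ (SL _ uS) (linked_refl G v) uv; rewrite addn0 addn1 => H.
apply: linkedS (H _); first by rewrite setUS // sub1set.
by rewrite disjoint_sym disjoints1.
Qed.

(** * Paths of prescribed length with many choices for both ends *)

Lemma disjoint_setUl (T : finType) (A B C : {set T}) :
  [disjoint A :|: B & C] = [disjoint A & C] && [disjoint B & C].
Proof. by rewrite -!setI_eq0 setIUl setU_eq0. Qed.

Lemma disjoint_setUr (T : finType) (A B C : {set T}) :
  [disjoint C & A :|: B] = [disjoint C & A] && [disjoint C & B].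
Proof. by rewrite -!setI_eq0 setIUr setU_eq0. Qed.

Lemma split_three (T : finType) (A : {set T}) (z : nat) :
  2 * z <= #|A| ->
  exists A1 A2 A3 : {set T}, [/\ A = A1 :|: A2 :|: A3,
    [/\ [disjoint A1 & A2], [disjoint A1 & A3] & [disjoint A2 & A3]],
    #|A1| = z, #|A2| = z & #|A3| = #|A| - 2 * z].
Proof.
move=> zA; have [A1 A1A c1] : exists2 A1 : {set T}, A1 \subset A & #|A1| = z.
  by apply: subset_card_eq; lia.
have cD : #|A :\: A1| = #|A| - z by rewrite -c1 cardsD (setIidPr A1A).
have [A2 A2A c2] : exists2 A2 : {set T}, A2 \subset A :\: A1 & #|A2| = z.
  by apply: subset_card_eq; lia.
exists A1, A2, ((A :\: A1) :\: A2).
have dA1 : [disjoint A1 & A :\: A1].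
  by rewrite -setI_eq0 setIDA setIC -setIDA setDv setI0.
have dA2 : [disjoint A2 & (A :\: A1) :\: A2].
  by rewrite -setI_eq0 setIDA setIC -setIDA setDv setI0.
split=> //.
- by rewrite -setUA -{1}(setIidPr A2A) setID -{1}(setIidPr A1A) setID.
- split=> //; first exact: disjointWr A2A dA1.
  by apply: disjointWr dA1; apply: subsetDl.
- by rewrite cardsD (setIidPr A2A) cD c2; lia.
Qed.

Lemma bip_alternate (T : finType) (G : sgraph T) (A B : {set T}) (p : seq T)
    (x0 : T) (i k : nat) :
  [disjoint A & B] -> sorted (bip G A B) p -> i + k < size p ->
  nth x0 p i \in A -> nth x0 p (i + k) \in if odd k then B else A.
Proof.
move=> dAB /(sortedP x0) sp; elim: k => [|k IH]; first by rewrite addn0.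
rewrite addnS => ik iA; have /IH /(_ iA) := ltnW ik.
have /andP[_] := sp _ ik; rewrite /=; case: (odd k) => /=.
  by case/orP => /andP[] // H _ H'; rewrite (disjointFr dAB H) in H'.
by case/orP => /andP[] // H _ H'; rewrite (disjointFl dAB H) in H'.
Qed.

Lemma joined_bad_card (T : finType) (G : sgraph T) (A B Y : {set T}) (m k : nat)
    (f : 'I_k -> T) :
  joined G m A B -> Y \subset B -> m <= #|Y| -> injective f -> (forall i, f i \in A) ->
  #|[set i | ~~ [exists y in Y, G (f i) y]]| < m.
Proof.
move=> /joinedP jAB YB mY fI fA; rewrite ltnNge; apply/negP => mb.
case: (jAB (f @: [set i | ~~ [exists y in Y, G (f i) y]]) Y) => //.
- by apply/subsetP => _ /imsetP[i _ ->].
- by rewrite card_imset.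
move=> x [y [/imsetP[i]]]; rewrite inE => /exists_inPn H -> yY.
by apply/negP; apply: H.
Qed.

(** Each side gives up two reserves of [z = (2 * q + 6) * m] vertices, the size at which
    [joined_clean] yields expansion [q + 2]. The depth-first search in the rest loses [4 * m + 1]
    vertices and the [2 * m] shifts by two need [4 * m]; altogether
    [4 * z + 8 * m + 1 <= (8 * q + 33) * m]. *)
Lemma dumbbell_core (T : finType) (G : sgraph T) (A B : {set T}) (m q d l h : nat) :
  [disjoint A & B] -> #|A| = h -> #|B| = h -> 0 < m -> joined G m A B ->
  2 <= q -> q ^ d.-1 <= m -> m <= q ^ d -> odd l -> l + (8 * q + 33) * m <= 2 * h ->
  exists S1 S2 : {set T}, [/\ S1 \subset (if odd d then A else B),
    S2 \subset (if odd d then B else A), m <= #|S1|, m <= #|S2| &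
    forall a b, a \in S1 -> b \in S2 -> linked G (A :|: B) a b (2 * d + l + 2)].
Proof.
move=> dAB cA cB m0 jAB q2 qd1 qd ol lh.
have jBA := joined_sym jAB.
pose z := (2 * q + 6) * m.
have zh : 2 * z <= h by rewrite /z; move: lh; clear; nia.
have [|A1 [A2 [A3 [AE [dA12 dA13 dA23] cA1 cA2 cA3]]]] := @split_three _ A z.
  by rewrite cA.
have [|B1 [B2 [B3 [BE [dB12 dB13 dB23] cB1 cB2 cB3]]]] := @split_three _ B z.
  by rewrite cB.
have sA1 : A1 \subset A by rewrite AE -setUA subsetUl.
have sA2 : A2 \subset A by rewrite AE (setUC A1) -setUA subsetUl.
have sA3 : A3 \subset A by rewrite AE subsetUr.
have sB1 : B1 \subset B by rewrite BE -setUA subsetUl.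
have sB2 : B2 \subset B by rewrite BE (setUC B1) -setUA subsetUl.
have sB3 : B3 \subset B by rewrite BE subsetUr.
have dd (C1 C3 D1 D3 : {set T}) : [disjoint C1 & C3] -> [disjoint D1 & D3] ->
    C1 \subset A -> C3 \subset A -> D1 \subset B -> D3 \subset B ->
    [disjoint C1 :|: D1 & C3 :|: D3].
  move=> dC dD C1A C3A D1B D3B; rewrite disjoint_setUl !disjoint_setUr dC dD andbT /=.
  rewrite (disjointWl C1A (disjointWr D3B dAB)) disjoint_sym.
  exact: disjointWl C3A (disjointWr D1B dAB).
have [||A1' [B1' [A1A B1B cA1' cB1' [eA1 eB1]]]] :=
    @joined_clean _ G A1 B1 m (q + 2) m0 (joinedS sA1 sB1 jAB).
- by rewrite cA1 /z; clear; nia.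
- by rewrite cB1 /z; clear; nia.
have [||A2' [B2' [A2A B2B cA2' cB2' [eA2 eB2]]]] :=
    @joined_clean _ G A2 B2 m (q + 2) m0 (joinedS sA2 sB2 jAB).
- by rewrite cA2 /z; clear; nia.
- by rewrite cB2 /z; clear; nia.
have mB1' : m <= #|B1'| by move: cB1' m0; rewrite cB1 /z; clear; nia.
have mA2' : m <= #|A2'| by move: cA2' m0; rewrite cA2 /z; clear; nia.
have dA3B3 : [disjoint A3 & B3] by apply: disjointWl sA3 _; apply: disjointWr sB3 _.
have [p [sp up pAB szp]] := exists_long_path dA3B3 cA3 (etrans cB3 (congr1 (subn^~ _) (etrans cB (esym cA)))) m0
   (joinedS sA3 sB3 jAB).
have szp' : l + 4 * m <= size p by move: szp lh m0; rewrite cA /z; clear; nia.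
have [x0 x0p] : exists x0, x0 \in p.
  by case: (p) szp' m0 => [|x ?] /=; [clear; lia | exists x; rewrite mem_head].
have spG : sorted G p by apply: sub_sorted sp => x y /andP[].
(* One of the positions 0 and 1 lies in [A3]. Shifts by two stay on that side, and [l] being odd
   puts the other end in [B3]. *)
have [a0 a01 a0A] : exists2 a0, a0 <= 1 & nth x0 p a0 \in A3.
  have s0 : 0 < size p by move: szp' m0; clear; lia.
  have /(_ (mem_nth x0 s0)) := pAB (nth x0 p 0).
  rewrite in_setU => /orP[H|H]; first by exists 0.
  exists 1 => //.
  have := @bip_alternate _ G B3 A3 p x0 0 1; rewrite add0n; apply=> //.
  - by rewrite disjoint_sym.
  - by rewrite (eq_sorted (bipC G B3 A3)).
  - by move: szp' m0; clear; lia.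
have lt1 (i : 'I_(2 * m)) : a0 + 2 * i + l < size p.
  by have := ltn_ord i; move: a01 szp'; clear; lia.
have inA (i : 'I_(2 * m)) : nth x0 p (a0 + 2 * i) \in A3.
  have := @bip_alternate _ G A3 B3 p x0 a0 (2 * i) dA3B3 sp _ a0A.
  by rewrite oddM /=; apply; apply: leq_ltn_trans (lt1 i); rewrite leq_addr.
have inB (i : 'I_(2 * m)) : nth x0 p (a0 + 2 * i + l) \in B3.
  have := @bip_alternate _ G A3 B3 p x0 (a0 + 2 * i) l dA3B3 sp (lt1 i) (inA i).
  by rewrite ol.
have inj k : k <= l -> injective (fun i : 'I_(2 * m) => nth x0 p (a0 + 2 * i + k)).
  move=> kl i j /eqP; rewrite nth_uniq //.
  - by move=> /eqP ij; apply: val_inj => /=; move: ij; clear; lia.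
  - by apply: leq_ltn_trans (lt1 i); rewrite leq_add2l.
  - by apply: leq_ltn_trans (lt1 j); rewrite leq_add2l.
(* Fewer than m of the 2m shifts of the subpath have no neighbour of their first
   end in B1', and likewise for their last end and A2'. *)
pose E1 := [set i : 'I_(2 * m) | ~~ [exists y in B1', G (nth x0 p (a0 + 2 * i + 0)) y]].
pose E2 := [set i : 'I_(2 * m) | ~~ [exists y in A2', G (nth x0 p (a0 + 2 * i + l)) y]].
have bad1 : #|E1| < m.
  apply: (joined_bad_card jAB (subset_trans B1B sB1) mB1' (inj 0 (leq0n _))) => i /=.
  by rewrite addn0; apply: (subsetP sA3).
have bad2 : #|E2| < m.
  apply: (joined_bad_card jBA (subset_trans A2A sA2) mA2' (inj l (leqnn _))) => i.
  exact: (subsetP sB3).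
have [i] : exists i : 'I_(2 * m), i \notin E1 :|: E2.
  apply/existsP; rewrite -negb_forall; apply/negP => /forallP all.
  have : #|[set: 'I_(2 * m)]| <= #|E1 :|: E2|.
    by apply: subset_leq_card; apply/subsetP => i _; apply: all.
  have : #|E1 :|: E2| <= #|E1| + #|E2| by apply: leq_card_setU.
  by rewrite cardsT card_ord; move: bad1 bad2; clear; lia.
rewrite in_setU negb_or !in_set !negbK addn0.
move=> /andP[/exists_inP[z1 z1B pz1] /exists_inP[z2 z2A pz2]].
have [S1 [S1s cS1 S1l]] := expander_layer q2 qd1 eB1 eA1 z1B.
have [S2 [S2s cS2 S2l]] := expander_layer q2 qd1 eA2 eB2 z2A.
exists S1, S2; split.
- by apply: subset_trans S1s _; case: ifP => _; [apply: subset_trans sA1 | apply: subset_trans sB1].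
- by apply: subset_trans S2s _; case: ifP => _; [apply: subset_trans sB2 | apply: subset_trans sA2].
- by rewrite cS1.
- by rewrite cS2.
move=> a b /S1l/linked_sym l1 /S2l l2.
have lp := linked_nth x0 spG up (lt1 i).
have {}lp : linked G (A3 :|: B3) (nth x0 p (a0 + 2 * i)) (nth x0 p (a0 + 2 * i + l)) l.
  by apply: linkedS lp; apply/subsetP => x; rewrite inE => /pAB.
have l1' : linked G (A1 :|: B1) a z1 d by apply: linkedS l1; rewrite setUC setUSS.
have l2' : linked G (A2 :|: B2) z2 b d by apply: linkedS l2; rewrite setUSS.
have l13 := linked_cat (dd _ _ _ _ dA13 dB13 sA1 sA3 sB1 sB3) l1' lp.
rewrite adj_sym in pz1; have {}l13 := l13 pz1.
have d2 : [disjoint A1 :|: B1 :|: (A3 :|: B3) & A2 :|: B2].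
  by rewrite disjoint_setUl dd //= disjoint_sym dd // disjoint_sym.
have l132 := linked_cat d2 l13 l2' pz2.
rewrite (_ : 2 * d + l + 2 = d + l + 1 + d + 1); last by clear; lia.
apply: linkedS l132.
have sU (C D : {set T}) : C \subset A -> D \subset B -> C :|: D \subset A :|: B.
  exact: setUSS.
by rewrite subUset; apply/andP; split; [rewrite subUset; apply/andP; split|]; apply: sU.
Qed.

(** A path with a tree at each end. The end sets are large enough for joinedness to attach them, and
    the length does not depend on the chosen ends. *)
Definition dumbbell (T : finType) (G : sgraph T) (m : nat) (Q S1 S2 : {set T}) (L : nat) :=
  [/\ S1 \subset Q, S2 \subset Q, m <= #|S1|, m <= #|S2| &
    forall a b, a \in S1 -> b \in S2 -> linked G Q a b L].

(** The leaves change sides with the parity of [d], so for even [d] the roles of [X] and [Y] are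
    exchanged. *)
Lemma dumbbell_exists (T : finType) (G : sgraph T) (X Y : {set T}) (m q d l h : nat) :
  [disjoint X & Y] -> #|X| = h -> #|Y| = h -> 0 < m -> joined G m X Y ->
  2 <= q -> q ^ d.-1 <= m -> m <= q ^ d -> odd l -> l + (8 * q + 33) * m <= 2 * h ->
  exists S1 S2 : {set T}, [/\ S1 \subset X, S2 \subset Y &
    dumbbell G m (X :|: Y) S1 S2 (2 * d + l + 2)].
Proof.
move=> dXY cX cY m0 jXY q2 qd1 qd ol lh.
case od : (odd d).
  have [S1 [S2 []]] := dumbbell_core dXY cX cY m0 jXY q2 qd1 qd ol lh.
  rewrite od => S1X S2Y mS1 mS2 ll; exists S1, S2; split=> //; split=> //.
    by apply: subset_trans S1X (subsetUl _ _).
  by apply: subset_trans S2Y (subsetUr _ _).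
rewrite disjoint_sym in dXY.
have [S1 [S2 []]] := dumbbell_core dXY cY cX m0 (joined_sym jXY) q2 qd1 qd ol lh.
rewrite od => S1X S2Y mS1 mS2 ll; exists S1, S2; split=> //; split=> //.
- by apply: subset_trans S1X (subsetUl _ _).
- by apply: subset_trans S2Y (subsetUr _ _).
by rewrite setUC.
Qed.

(** * Cycles through several joined pairs *)

(** The set of reached vertices keeps size [m] from block to block, since fewer than [m] of the at
    least [2 * m] free vertices of the next reserve are missed. [F] holds the vertices used
    elsewhere; repetitions within the walk are excluded because [p] repeats no index and the
    reserves are disjoint. *)
Lemma connecting_path (T I : finType) (G : sgraph T) (m : nat) (r : rel I)
    (V W : I -> {set T}) (F S S' : {set T}) (i j : I) (p : seq I) :
  0 < m -> (forall i j, r i j -> joined G m (V i) (V j)) ->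
  (forall i, W i \subset V i) -> (forall i j, i != j -> [disjoint W i & W j]) ->
  path r i (rcons p j) -> uniq p -> (forall k, k \in p -> 2 * m <= #|W k :\: F|) ->
  S \subset V i -> m <= #|S| -> S' \subset V j -> m <= #|S'| ->
  exists s t ws, [/\ s \in S, t \in S', path G s (rcons ws t) &
    [/\ uniq ws, size ws = size p & forall w, w \in ws -> exists2 k, k \in p & w \in W k :\: F]].
Proof.
move=> m0 rV WV dW; elim: p i S => [|k p IH] i S /=.
  rewrite andbT => rij _ _ SV mS S'V mS'.
  have [s [t [sS tS' st]]] := joinedP _ _ _ _ (rV _ _ rij) _ _ SV S'V mS mS'.
  by exists s, t, [::]; split; rewrite //= st.
move=> /andP[rik pk] /andP[kp up] WF SV mS S'V mS'.
pose S1 := nbr G S :&: (W k :\: F).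
have WFV : W k :\: F \subset V k by apply: subset_trans (subsetDl _ _) (WV _).
have mS1 : m <= #|S1|.
  have := joined_nbr (rV _ _ rik) SV WFV mS m0.
  have := WF k (mem_head _ _); rewrite -(cardsID (nbr G S)) setIC -/S1; clear; lia.
have S1V : S1 \subset V k by apply: subset_trans (subsetIr _ _) WFV.
have [|s [t [ws [sS1 tS' pws [uws sws wW]]]]] := IH k S1 pk up _ S1V mS1 S'V mS'.
  by move=> k' k'p; apply: WF; rewrite inE k'p orbT.
move: (sS1); rewrite in_setI => /andP[/nbrP[s' s'S s's] sW].
exists s', t, (s :: ws); split=> //=; first by rewrite s's.
split.
- rewrite uws andbT; apply/negP => /wW[k' k'p]; rewrite in_setD => /andP[_ sWk'].
  have kk' : k != k' by apply: contraNneq kp => ->.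
  by move: sW; rewrite in_setD (disjointFl (dW _ _ kk') sWk') andbF.
- by rewrite sws.
- move=> w; rewrite inE => /predU1P[->|/wW[k' k'p wk']].
    by exists k; rewrite // mem_head.
  by exists k'; rewrite // inE k'p orbT.
Qed.

Lemma dumbbell_cat (T : finType) (G : sgraph T) (m : nat) (Q Q' S1 S2 S1' S2' : {set T})
    (L L' : nat) (s t : T) (ws : seq T) :
  dumbbell G m Q S1 S2 L -> dumbbell G m Q' S1' S2' L' -> [disjoint Q & Q'] ->
  s \in S2 -> t \in S1' -> path G s (rcons ws t) -> uniq ws ->
  [disjoint Q & [set w in ws]] -> [disjoint Q' & [set w in ws]] ->
  dumbbell G m (Q :|: [set w in ws] :|: Q') S1 S2' (L + L' + size ws + 1).
Proof.
move=> [S1Q S2Q mS1 mS2 ll] [S1Q' S2Q' mS1' mS2' ll'] dQ sS tS pws uws dQw dQw'.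
split=> //.
- by apply: subset_trans S1Q _; rewrite -setUA subsetUl.
- by apply: subset_trans S2Q' (subsetUr _ _).
move=> a b aS bS; have la := ll _ _ aS sS; have lb := ll' _ _ tS bS.
case: ws => [|w ws] in pws uws dQw dQw' *.
  move: pws; rewrite /= andbT addn0 => st.
  apply: linkedS (linked_cat dQ la lb st).
  by rewrite setSU // subsetUl.
move: pws; rewrite /= rcons_path => /and3P[sw pws wt].
have lw : linked G [set x in w :: ws] w (last w ws) (size ws).
  by exists ws; split=> // x; rewrite in_set.
have l1 := linked_cat dQw la lw sw.
have d2 : [disjoint Q :|: [set x in w :: ws] & Q'].
  by rewrite disjoint_setUl dQ disjoint_sym.
have := linked_cat d2 l1 lb wt.
by rewrite (_ : L + size ws + 1 + L' + 1 = L + L' + (size ws).+1 + 1) //; clear; lia.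
Qed.

Lemma dumbbell_close (T : finType) (G : sgraph T) (m : nat) (Q S1 S2 : {set T})
    (L : nat) (s t : T) (ws : seq T) :
  dumbbell G m Q S1 S2 L -> s \in S2 -> t \in S1 -> path G s (rcons ws t) -> uniq ws ->
  [disjoint Q & [set w in ws]] -> 2 <= L -> has_cycle G (L + size ws + 1).
Proof.
move=> [_ _ _ _ ll] sS tS pws uws dQw L2.
have [p [pp lp sp up pQ]] := ll _ _ tS sS.
split; first by move: L2; clear; lia.
exists (t :: p ++ ws); first by rewrite /= size_cat sp; clear; lia.
rewrite /ucycle /= rcons_cat cat_path pp lp pws /= -cons_uniq -cat_cons cat_uniq up uws andbT andTb.
apply/negP => /hasP[x xw xp].
by have := disjointFr dQw (pQ _ xp); rewrite inE xw.
Qed.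

Lemma path_predecessor (I : eqType) (r : rel I) (i j : I) (p : seq I) :
  path r i p -> j \in p -> exists k, r k j.
Proof.
elim: p i => //= x p IH i /andP[ix px]; rewrite inE => /predU1P[->|]; first by exists i.
exact: IH px.
Qed.

(** At most [k] connecting walks, with at most [b] inner vertices each, ever touch the reserves, so
    a reserve of [2 * m + k * b] vertices always keeps [2 * m] free ones. This is why [chain]
    records the number of reserve vertices in [Q]; the dumbbells themselves avoid all reserves. *)
Lemma cycle_of_links (T I : finType) (G : sgraph T) (m D d h k b : nat) (r : rel I)
    (V W : I -> {set T}) (x y : nat -> I) (X Y : nat -> {set T}) (l : nat -> nat)
    (w : nat -> seq I) :
  0 < m -> 2 <= D -> D ^ d.-1 <= m -> m <= D ^ d ->
  (forall i j, r i j -> joined G m (V i) (V j)) ->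
  (forall i, W i \subset V i) -> (forall i j, i != j -> [disjoint W i & W j]) ->
  (forall i j, r i j -> 2 * m + k * b <= #|W j|) ->
  (forall i, i < k -> [/\ X i \subset V (x i), Y i \subset V (y i), #|X i| = h & #|Y i| = h]) ->
  (forall i, i < k -> joined G m (V (x i)) (V (y i)) /\ [disjoint X i & Y i]) ->
  (forall i j, i < k -> j < k -> i != j -> [disjoint X i :|: Y i & X j :|: Y j]) ->
  (forall i j, i < k -> [disjoint X i :|: Y i & W j]) ->
  (forall i, i < k -> [/\ path r (y i) (rcons (w i) (x i.+1)), uniq (w i) & size (w i) <= b]) ->
  (forall i, i < k -> odd (l i) /\ l i + (8 * D + 33) * m <= 2 * h) ->
  0 < k -> x k = x 0 ->
  has_cycle G (\sum_(i < k) (2 * d + l i + 2 + size (w i) + 1)).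
Proof.
move=> m0 D2 Dm mD rV WV dW cW XY rxy dXY dXYW walk ol k0 xk.
pose Wall := \bigcup_(i : I) W i.
have db i : i < k -> exists S1 S2 : {set T}, [/\ S1 \subset X i, S2 \subset Y i &
    dumbbell G m (X i :|: Y i) S1 S2 (2 * d + l i + 2)].
  move=> ik; have [XV YV cX cY] := XY i ik; have [rr dd] := rxy i ik; have [oo hl] := ol i ik.
  apply: (dumbbell_exists dd cX cY m0 _ D2 Dm mD oo hl).
  exact: joinedS XV YV rr.
have free (Q : {set T}) j i : j < k -> #|Q :&: Wall| <= k * b -> i \in w j -> 2 * m <= #|W i :\: Q|.
  move=> jk QW iw; have [pw _ _] := walk j jk.
  have [|i' /cW] := @path_predecessor _ r (y j) i _ pw; first by rewrite mem_rcons inE iw orbT.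
  rewrite -(cardsID Q (W i)).
  have : #|W i :&: Q| <= #|Q :&: Wall|.
    by apply: subset_leq_card; rewrite setIC setIS // (bigcup_sup i).
  by move: QW; clear; lia.
have chain j : j < k -> exists Q S1 S2 : {set T}, [/\
    Q \subset \bigcup_(i < j.+1) (X i :|: Y i) :|: Wall, S1 \subset X 0, S2 \subset Y j,
    #|Q :&: Wall| <= j * b &
    dumbbell G m Q S1 S2 (\sum_(i < j.+1) (2 * d + l i + 2) + \sum_(i < j) (size (w i) + 1))].
  elim: j => [|j IH] jk.
    have [S1 [S2 [S1X S2Y ds]]] := db 0 jk.
    exists (X 0 :|: Y 0), S1, S2; split=> //.
    - by rewrite big_ord_recl big_ord0 setU0 subsetUl.
    - rewrite leqn0 cards_eq0 setI_eq0 -setI_eq0 setIC big_distrl /= big1 // => i _.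
      by apply/eqP; rewrite setI_eq0 disjoint_sym dXYW.
    - by rewrite big_ord_recl !big_ord0 !addn0.
  have [Q [S1 [S2 [QXY S1X S2Y QW dQ]]]] := IH (ltnW jk).
  have [S1' [S2' [S1'X S2'Y dQ']]] := db _ jk.
  have [pw uw sw] := walk j (ltnW jk).
  have [_ YV _ _] := XY j (ltnW jk); have [XV _ _ _] := XY j.+1 jk.
  have QWk : #|Q :&: Wall| <= k * b.
    by apply: leq_trans QW _; rewrite leq_mul2r ltnW ?orbT // ltnW.
  have [_ _ _ mS2 _] := dQ; have [_ _ mS1' _ _] := dQ'.
  have [s [t [ws [sS tS pws [uws sws wW]]]]] := connecting_path m0 rV WV dW pw uw
    (fun i => free Q j i (ltnW jk) QWk) (subset_trans S2Y YV) mS2 (subset_trans S1'X XV) mS1'.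
  have dQ1 : [disjoint Q & [set x in ws]].
    rewrite disjoint_sym disjoints_subset; apply/subsetP => z; rewrite !inE => /wW[i _].
    by rewrite in_setD => /andP[].
  have dQ2 : [disjoint X j.+1 :|: Y j.+1 & [set x in ws]].
    rewrite disjoint_sym disjoints_subset; apply/subsetP => z; rewrite in_set => /wW[i _].
    by rewrite in_setD in_setC => /andP[_ /(disjointFl (dXYW j.+1 i jk)) ->].
  have dQ3 : [disjoint Q & X j.+1 :|: Y j.+1].
    apply: disjointWl QXY _; rewrite disjoint_setUl; apply/andP; split.
      rewrite disjoint_sym; apply/bigcup_disjointP => i _.
      have ij : i < j.+1 := ltn_ord i.
      apply: dXY => //; first exact: ltn_trans jk.
      by rewrite neq_ltn ij orbT.
    by rewrite disjoint_sym; apply/bigcup_disjointP => i _; apply: dXYW.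
  have := dumbbell_cat dQ dQ' dQ3 sS tS pws uws dQ1 dQ2.
  have -> : \sum_(i < j.+1) (2 * d + l i + 2) + \sum_(i < j) (size (w i) + 1) +
      (2 * d + l j.+1 + 2) + size ws + 1 =
      \sum_(i < j.+2) (2 * d + l i + 2) + \sum_(i < j.+1) (size (w i) + 1).
    by rewrite [in RHS]big_ord_recr [X in _ = _ + X]big_ord_recr /= sws; clear; lia.
  move=> dres; exists (Q :|: [set x in ws] :|: (X j.+1 :|: Y j.+1)), S1, S2'; split=> //.
  - rewrite big_ord_recr /=; apply/subsetP => z; rewrite !in_setU -orbA.
    case/or3P => [/(subsetP QXY)|zw|->]; rewrite ?in_setU ?orbT //.
      by case/orP => ->; rewrite ?orbT.
    apply/orP; right; move: zw; rewrite in_set => /wW[i _]; rewrite in_setD => /andP[_ zW].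
    by apply/bigcupP; exists i.
  - have sub : (Q :|: [set x in ws] :|: (X j.+1 :|: Y j.+1)) :&: Wall \subset
        (Q :&: Wall) :|: [set x in ws].
      apply/subsetP => z; rewrite in_setI !in_setU in_setI -orbA => /andP[/or3P[->|->|zX] zW].
      + by rewrite zW.
      + by rewrite orbT.
      + by case/bigcupP: zW => i _; rewrite (disjointFr (dXYW _ i jk)) // in_setU.
    apply: leq_trans (subset_leq_card sub) _.
    apply: leq_trans (leq_card_setU _ _) _.
    have : #|[set x in ws]| <= b by rewrite cardsE; apply: leq_trans (card_size _) _; rewrite sws.
    by move: QW; rewrite mulSn; clear; lia.
have k1 : k.-1 < k by rewrite prednK.
have [Q [S1 [S2 [QXY S1X S2Y QW dQ]]]] := chain _ k1.
have [pw uw sw] := walk _ k1.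
have [_ YV _ _] := XY _ k1; have [XV _ _ _] := XY 0 k0.
have QWk : #|Q :&: Wall| <= k * b.
  by apply: leq_trans QW _; rewrite leq_mul2r leq_pred orbT.
have [_ _ mS1 mS2 _] := dQ.
have S1V : S1 \subset V (x k.-1.+1) by rewrite prednK // xk; apply: subset_trans XV.
have [s [t [ws [sS tS pws [uws sws wW]]]]] := connecting_path m0 rV WV dW pw uw
    (fun i => free Q _ i k1 QWk) (subset_trans S2Y YV) mS2 S1V mS1.
have dQ1 : [disjoint Q & [set x in ws]].
  rewrite disjoint_sym disjoints_subset; apply/subsetP => z; rewrite !inE => /wW[i _].
  by rewrite in_setD => /andP[].
have := dumbbell_close dQ sS tS pws uws dQ1; rewrite sws.
have E n : \sum_(i < n.+1) (2 * d + l i + 2) + \sum_(i < n) (size (w i) + 1) +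
    size (w n) + 1 = \sum_(i < n.+1) (2 * d + l i + 2 + size (w i) + 1).
  under [in RHS]eq_bigr do rewrite -addnA.
  by rewrite [in RHS]big_split /= [X in _ = _ + X]big_ord_recr /= !addnA.
rewrite E prednK //; apply.
by rewrite (bigD1 (Ordinal k0)) //=; clear; lia.
Qed.

(** * Matchings in the double cover of a dense graph *)

(** The bipartite graph between two copies of [I] is given by its edges and their end maps, so that
    exchanging the sides means exchanging [f] and [g]. *)
Definition covers (I J : finType) (f g : J -> I) (M : {set J}) (X Y : {set I}) : bool :=
  [forall z in M, (f z \in X) || (g z \in Y)].

Lemma coversP (I J : finType) (f g : J -> I) (M : {set J}) (X Y : {set I}) :
  reflect (forall z, z \in M -> f z \in X \/ g z \in Y) (covers f g M X Y).
Proof. by apply: (iffP forall_inP) => H z /H /orP. Qed.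

Lemma coversC (I J : finType) (f g : J -> I) (M : {set J}) (X Y : {set I}) :
  covers f g M X Y = covers g f M Y X.
Proof. by apply: eq_forallb => z; rewrite orbC. Qed.

(* If two edges [z], [z'] share their left end, small covers of [M :\ z] and
   [M :\ z'] uncross to two covers of [M], one of which is small. *)
Lemma critical_inj (I J : finType) (f g : J -> I) (M : {set J}) (Q : nat) :
  (forall X Y, covers f g M X Y -> Q <= #|X| + #|Y|) ->
  (forall z, z \in M -> exists X Y, covers f g (M :\ z) X Y /\ #|X| + #|Y| < Q) ->
  {in M &, injective f}.
Proof.
move=> big small z z' zM z'M fzz'; apply/eqP; apply: contraT => nzz'.
have [X [Y [/coversP cXY sXY]]] := small z zM.
have [X' [Y' [/coversP cXY' sXY']]] := small z' z'M.
have zX : f z \notin X.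
  apply/negP => zX; suff : Q <= #|X| + #|Y| by rewrite leqNgt sXY.
  apply: big; apply/coversP => t tM; case: (eqVneq t z) => [->|tz]; first by left.
  by apply: cXY; rewrite in_setD1 tz.
have zX' : f z' \notin X'.
  apply/negP => zX'; suff : Q <= #|X'| + #|Y'| by rewrite leqNgt sXY'.
  apply: big; apply/coversP => t tM; case: (eqVneq t z') => [->|tz]; first by left.
  by apply: cXY'; rewrite in_setD1 tz.
have z'Y : g z' \in Y.
  by case: (cXY z'); rewrite ?in_setD1 1?eq_sym ?nzz' // -fzz' (negbTE zX).
have zY' : g z \in Y'.
  by case: (cXY' z); rewrite ?in_setD1 ?nzz' // fzz' (negbTE zX').
have b1 : Q <= #|X :&: X'| + #|Y :|: Y'|.
  apply: big; apply/coversP => t tM; rewrite in_setI in_setU.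
  case: (eqVneq t z) => [->|tz]; first by right; rewrite zY' orbT.
  case: (eqVneq t z') => [->|tz']; first by right; rewrite z'Y.
  case: (cXY t); rewrite ?in_setD1 ?tz // => -> /=; last by right.
  case: (cXY' t); rewrite ?in_setD1 ?tz' // => ->; first by left.
  by right; rewrite orbT.
have b2 : Q <= #|f z |: (X :|: X')| + #|Y :&: Y'|.
  apply: big; apply/coversP => t tM; rewrite in_setI in_setU1 in_setU.
  case: (eqVneq t z) => [->|tz]; first by left; rewrite eqxx.
  case: (eqVneq t z') => [->|tz']; first by left; rewrite fzz' eqxx.
  case: (cXY t); rewrite ?in_setD1 ?tz // => -> /=; first by left; rewrite orbT.
  by case: (cXY' t); rewrite ?in_setD1 ?tz' // => ->; [left; rewrite !orbT | right].
have := leq_trans b2 (leq_add (_ : _ <= #|X :|: X'| + 1) (leqnn _)).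
rewrite cardsU1 addnC leq_add2l => /(_ (leq_b1 _)).
move: b1 sXY sXY'; have := cardsUI X X'; have := cardsUI Y Y'; clear; lia.
Qed.

(** In a minimal edge set that still needs covers of size [Q], deleting any edge admits a smaller
    cover, and uncrossing shows that no two edges share an end. The left ends alone form a cover, so
    at least [Q] edges remain. *)
Lemma koenig (I J : finType) (f g : J -> I) (E : {set J}) (Q : nat) :
  (forall X Y, covers f g E X Y -> Q <= #|X| + #|Y|) ->
  exists M : {set J}, [/\ M \subset E, Q <= #|M|, {in M &, injective f} &
                          {in M &, injective g}].
Proof.
move=> big.
pose P (M : {set J}) := [forall X, forall Y, covers f g M X Y ==> (Q <= #|X| + #|Y|)].
have PP M : reflect (forall X Y, covers f g M X Y -> Q <= #|X| + #|Y|) (P M).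
  apply: (iffP forallP) => [H X Y|H X]; first by move/forallP: (H X) => /(_ Y) /implyP.
  by apply/forallP => Y; apply/implyP; apply: H.
have [M /minsetP[/PP PM min] ME] := minset_exists (introT (PP E) big).
have small z : z \in M -> exists X Y, covers f g (M :\ z) X Y /\ #|X| + #|Y| < Q.
  move=> zM; have : ~~ P (M :\ z).
    apply/negP => /min /(_ (subD1set _ _)) H.
    by move: (in_setD1 z M z); rewrite H zM eqxx.
  case/forallPn => X /forallPn[Y]; rewrite negb_imply -ltnNge => /andP[? ?].
  by exists X, Y.
exists M; split=> //.
- have := PM (f @: M) set0; rewrite cards0 addn0 => H.
  apply: leq_trans (leq_imset_card f M); apply: H.
  by apply/coversP => z zM; left; apply: imset_f.
- exact: (critical_inj PM).
apply: (@critical_inj _ _ g f M Q).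
  by move=> X Y; rewrite coversC addnC; apply: PM.
move=> z /small[X [Y [c s]]]; exists Y, X; split; first by rewrite coversC.
by rewrite addnC.
Qed.

Definition arcs (I : finType) (r : rel I) (C : {set I}) : {set I * I} :=
  [set z | [&& z.1 \in C, z.2 \in C & r z.1 z.2]].

(** Here [a] counts the vertices of [C] in both [X] and [Y], and [b] those in exactly one. As an arc
    and its reverse are both covered, an arc without an end of the first kind has both ends of the
    second. *)
Lemma covered_arcs (I : finType) (r : rel I) (C X Y : {set I}) :
  covers fst snd (arcs r C) X Y -> symmetric r ->
  exists a b, [/\ 2 * a + b <= #|X| + #|Y|, a + b <= #|C| &
    #|arcs r C| + a * a <= 2 * a * #|C| + b * b].
Proof.
move=> /coversP cov rs.
pose A := (X :&: Y) :&: C; pose B := ((X :\: Y) :|: (Y :\: X)) :&: C.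
exists #|A|, #|B|.
have XE : #|X :\: Y| + #|X :&: Y| = #|X| by rewrite addnC cardsID.
have YE : #|Y :\: X| + #|X :&: Y| = #|Y| by rewrite addnC setIC cardsID.
have Ale : #|A| <= #|X :&: Y| by rewrite subset_leq_card // subsetIl.
have Ble : #|B| <= #|X :\: Y| + #|Y :\: X|.
  apply: leq_trans (subset_leq_card (subsetIl _ _)) _; exact: leq_card_setU.
have AC : A \subset C by apply: subsetIr.
split.
- by move: XE YE Ale Ble; clear; lia.
- have dAB : #|A :&: B| = 0.
    apply/eqP; rewrite cards_eq0; apply/eqP/setP => x; rewrite !inE.
    by case: (x \in X) (x \in Y) (x \in C) => [] [] [].
  have := cardsUI A B; rewrite dAB addn0 => <-.
  by rewrite subset_leq_card // subUset AC subsetIr.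
have sub : arcs r C \subset (setX A C :|: setX C A) :|: setX B B.
  apply/subsetP => -[u v] uv; move: (uv); rewrite inE /= => /and3P[uC vC ruv].
  have vu : (v, u) \in arcs r C by rewrite inE /= uC vC rs.
  move: (cov _ uv) (cov _ vu) => /= /orP + /orP; rewrite !inE /= uC vC.
  by case: (u \in X) (v \in X) (u \in Y) (v \in Y) => [] [] [] [].
have := subset_leq_card sub.
have : #|setX A C :|: setX C A :|: setX B B| <= #|setX A C :|: setX C A| + #|setX B B|.
  exact: leq_card_setU.
have := cardsUI (setX A C) (setX C A).
have -> : setX A C :&: setX C A = setX A A.
  apply/setP => -[u v]; rewrite !inE /=.
  by case: (u \in X) (v \in X) (u \in Y) (v \in Y) (u \in C) (v \in C) => [] [] [] [] [] [].
rewrite !cardsX (mulnC #|C|) -mulnA.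
move: #|setX A C :|: setX C A :|: setX B B| #|setX A C :|: setX C A| #|arcs r C| => x y z.
move: (#|A| * #|A|) (#|A| * #|C|) (#|B| * #|B|) => p q s; clear; lia.
Qed.

Definition component (I : finType) (r : rel I) (v : I) : {set I} :=
  [set w | connect r v w].

Lemma component_edge (I : finType) (r : rel I) (v u w : I) :
  u \in component r v -> r u w -> w \in component r v.
Proof. by rewrite !inE => vu uw; apply: connect_trans vu (connect1 uw). Qed.

Lemma sum_degrees (I : finType) (r : rel I) (A B : {set I}) :
  \sum_(u in A) #|[set w in B | r u w]| = #|[set z | [&& z.1 \in A, z.2 \in B & r z.1 z.2]]|.
Proof.
rewrite -sum1_card (partition_big fst (mem A)) /=; last by move=> z; rewrite inE => /andP[].
apply: eq_bigr => u uA.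
rewrite -[LHS]sum1_card [RHS](reindex_onto (pair u) snd) /=.
  by apply: eq_bigl => w; rewrite !inE /= !eqxx !andbT uA.
by move=> [a b]; rewrite inE /= => /andP[_ /eqP->].
Qed.

Definition support_in (I : finType) (r : rel I) (P : {set I}) : Prop :=
  forall x y, r x y -> x \in P /\ y \in P.

Lemma component_sub (I : finType) (r : rel I) (P : {set I}) (v : I) :
  support_in r P -> v \in P -> component r v \subset P.
Proof.
move=> rP vP; apply/subsetP => w; rewrite inE => /connectP[p pp ->].
by elim: p v vP pp => //= x p IH v vP /andP[/rP[_ xP]]; apply: IH.
Qed.

(* A matching of the bipartite double cover: each vertex may occur once as first
   and once as second end, for which its block is split into two halves. *)
Definition component_matching (I : finType) (r : rel I) (v : I) (Q : nat) : Prop :=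
  exists M : {set I * I}, [/\ Q <= #|M|, {in M &, injective fst}, {in M &, injective snd} &
    forall z, z \in M -> r z.1 z.2 /\ z.1 \in component r v].

Lemma matching_or_cover (I : finType) (r : rel I) (v : I) (Q : nat) :
  symmetric r -> component_matching r v Q.+1 \/
  exists a b, [/\ 2 * a + b <= Q, a + b <= #|component r v| &
    #|arcs r (component r v)| + a * a <= 2 * a * #|component r v| + b * b].
Proof.
move=> rs; set C := component r v.
case: (boolP [forall X : {set I}, forall Y : {set I},
    covers fst snd (arcs r C) X Y ==> (Q.+1 <= #|X| + #|Y|)]) => [/forallP H|].
  left; have [|M [ME QM i1 i2]] := @koenig _ _ fst snd (arcs r C) Q.+1.
    by move=> X Y; move/forallP: (H X) => /(_ Y)/implyP.
  exists M; split=> // z /(subsetP ME); rewrite inE => /and3P[]; by split.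
case/forallPn => X /forallPn[Y]; rewrite negb_imply -leqNgt => /andP[cov s].
right; have [a [b [ab1 ab2 ab3]]] := covered_arcs cov rs.
by exists a, b; split=> //; apply: leq_trans ab1 s.
Qed.

(** By averaging, some component has more than [Q] arcs per vertex. If it has order [c], a cover
    with [2 * a + b <= Q] would allow at most [2 * a * c + b * b <= Q * c] arcs, as [b <= c]. *)
Lemma dense_component_matching (I : finType) (r : rel I) (P : {set I}) (Q : nat) :
  symmetric r -> support_in r P -> Q * #|P| < #|[set z | r z.1 z.2]| ->
  exists2 v, v \in P & component_matching r v Q.+1.
Proof.
move=> rs rP.
have csym : connect_sym r by apply: sym_connect_sym.
case: (boolP [exists v in P, #|component r v| * Q < #|arcs r (component r v)|]).
  case/exists_inP => v vP big _; exists v => //.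
  case: (matching_or_cover v Q rs) => // -[a [b [ab1 ab2 ab3]]].
  by exfalso; move: ab1 ab2 ab3 big; clear; nia.
move/exists_inPn => small; rewrite ltnNge => /negP; case.
have arcE : #|[set z | r z.1 z.2]| = \sum_(u in P) #|[set w in P | r u w]|.
  rewrite sum_degrees; congr #|pred_of_set _|; apply/setP => z; rewrite !inE.
  by case: (boolP (r z.1 z.2)) => [/rP[-> ->]|]; rewrite ?andbF.
rewrite arcE mulnC -sum_nat_const.
rewrite (partition_big (fingraph.root r) (fun u => (u \in P) && (roots r u))) /=; last first.
  move=> u uP; rewrite roots_root // andbT.
  by apply: (subsetP (component_sub rP uP)); rewrite inE connect_root.
rewrite [leqRHS](partition_big (fingraph.root r) (fun u => (u \in P) && (roots r u))) /=; last first.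
  move=> u uP; rewrite roots_root // andbT.
  by apply: (subsetP (component_sub rP uP)); rewrite inE connect_root.
apply: leq_sum => v /andP[vP vr].
have compE u : (u \in P) && (fingraph.root r u == v) = (u \in component r v).
  apply/andP/idP => [[_ /eqP uv]|vu].
    by rewrite inE -(root_connect csym) (eqP vr) uv.
  split; first exact: (subsetP (component_sub rP vP)).
  by move: vu; rewrite inE -(root_connect csym) (eqP vr) eq_sym.
rewrite (eq_bigl _ _ compE) [leqRHS](eq_bigl _ _ compE) sum_nat_const.
apply: leq_trans (_ : _ <= #|arcs r (component r v)|) _; last by rewrite leqNgt small.
rewrite -sum_degrees; apply: leq_sum => u uC; apply: subset_leq_card.
apply/subsetP => w; rewrite !inE => /andP[_ uw]; rewrite uw andbT.
by have := component_edge uC uw; rewrite inE.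
Qed.

(* The second component records the parity of the length of a walk. *)
Definition parity_rel (I : finType) (r : rel I) : rel (I * bool) :=
  fun z w => r z.1 w.1 && (z.2 != w.2).

Lemma parity_rel_sym (I : finType) (r : rel I) : symmetric r -> symmetric (parity_rel r).
Proof. by move=> rs z w; rewrite /parity_rel rs eq_sym. Qed.

Lemma parity_connect_flip (I : finType) (r : rel I) (z w : I * bool) :
  connect (parity_rel r) z w -> connect (parity_rel r) (z.1, ~~ z.2) (w.1, ~~ w.2).
Proof.
case/connectP => p pp ->; elim: p z pp => //= x p IH z /andP[zx /IH]; apply: connect_trans.
apply: connect1; move: zx; rewrite /parity_rel /=.
by case: (z.2) (x.2) => [] [].
Qed.

Lemma parity_connect_exists (I : finType) (r : rel I) (v w : I) :
  w \in component r v -> exists b, connect (parity_rel r) (v, false) (w, b).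
Proof.
rewrite inE => /connectP[p pp ->]; move: false => a.
elim: p v a pp => [|x p IH] v a /=; first by exists a; apply: connect0.
move=> /andP[vx /(IH x (~~ a))[b H]]; exists b; apply: connect_trans H.
by apply: connect1; rewrite /parity_rel /= vx; case: a.
Qed.

(** Without an odd closed walk at [v], the vertices reached by even walks and the remaining ones
    form two sides, of sizes [x] and [y]; every arc crosses, and [4 * x * y <= (x + y) ^ 2]. *)
Lemma bipartite_component_arcs (I : finType) (r : rel I) (v : I) :
  symmetric r -> ~~ connect (parity_rel r) (v, false) (v, true) ->
  2 * #|arcs r (component r v)| <= #|component r v| * #|component r v|.
Proof.
move=> rs nbip; set C := component r v.
have psym := sym_connect_sym (parity_rel_sym rs).
pose C0 := [set w in C | connect (parity_rel r) (v, false) (w, false)].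
have side w : connect (parity_rel r) (v, false) (w, true) ->
    ~~ connect (parity_rel r) (v, false) (w, false).
  move=> vw; apply: contra nbip => /parity_connect_flip /= vw'.
  by apply: connect_trans vw _; rewrite psym.
have C0C : C0 \subset C by apply/subsetP => w; rewrite inE => /andP[].
have sub : arcs r C \subset setX C0 (C :\: C0) :|: setX (C :\: C0) C0.
  apply/subsetP => -[u w]; rewrite !inE /= => /and3P[vu vw uw].
  rewrite vu vw /= !andbT.
  case: (boolP (connect _ _ (u, false))) => cu /=.
    rewrite orbF; apply: side; apply: connect_trans cu (connect1 _).
    by rewrite /parity_rel /= uw.
  have [|[] cu'] := @parity_connect_exists _ r v u; first by rewrite inE.
    apply: connect_trans cu' (connect1 _).
    by rewrite /parity_rel /= uw.
  by rewrite cu' in cu.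
have := subset_leq_card sub.
have : #|setX C0 (C :\: C0) :|: setX (C :\: C0) C0| <=
    #|setX C0 (C :\: C0)| + #|setX (C :\: C0) C0| by apply: leq_card_setU.
have := cardsID C0 C; rewrite (setIidPr C0C) !cardsX => <-.
move: #|_ :|: _| #|arcs r C| #|C0| #|C :\: C0| => x y a b; clear.
have [+ _] := nat_AGM2 a b; rewrite -!mulnn; nia.
Qed.

(** The component of a vertex of maximum degree contains at least half of [P]: all degrees are at
    most its order [c], and there are more than [#|P| ^ 2 / 2] arcs. At most [(#|P| - c) ^ 2] arcs
    lie outside, so the component has more arcs than a small cover or a bipartition allows. *)
Lemma very_dense_component_matching (I : finType) (r : rel I) (P : {set I}) (Q : nat) :
  symmetric r -> support_in r P -> Q <= #|P| -> #|P| <= 2 * Q ->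
  Q * Q + (#|P| - Q) * (#|P| - Q) < #|[set z | r z.1 z.2]| ->
  exists v, [/\ v \in P, component_matching r v Q.+1 &
                connect (parity_rel r) (v, false) (v, true)].
Proof.
move=> rs rP QP PQ big.
have arcE : #|[set z | r z.1 z.2]| = \sum_(u in P) #|[set w in P | r u w]|.
  rewrite sum_degrees; congr #|pred_of_set _|; apply/setP => z; rewrite !inE.
  by case: (boolP (r z.1 z.2)) => [/rP[-> ->]|]; rewrite ?andbF.
have [v0 v0P] : exists v0, v0 \in P.
  apply/set0Pn; apply: contraTneq big => P0; rewrite -leqNgt arcE P0 big_pred0 // => u.
  by rewrite in_set0.
case: (@arg_maxnP _ v0 (mem P) (fun u => #|[set w in P | r u w]|) v0P) => v vP vmax.
set C := component r v.
have CP : #|C| <= #|P| by apply: subset_leq_card (component_sub rP vP).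
have degC : #|[set w in P | r v w]| <= #|C|.
  apply: subset_leq_card; apply/subsetP => w; rewrite !inE => /andP[_ vw].
  exact: connect1.
have arcle : #|[set z | r z.1 z.2]| <= #|P| * #|C|.
  rewrite arcE -sum_nat_const; apply: leq_sum => u uP.
  exact: leq_trans (vmax u uP) degC.
have C2 : #|P| <= 2 * #|C|.
  rewrite leqNgt; apply/negP; move: big arcle QP PQ; clear.
  move: #|[set z | r z.1 z.2]| #|P| #|C| => A k c; nia.
have split : #|[set z | r z.1 z.2]| <= #|arcs r C| + (#|P| - #|C|) * (#|P| - #|C|).
  have cD : #|P| - #|C| = #|P :\: C|.
    by rewrite cardsD (setIidPr (component_sub rP vP)).
  rewrite cD -cardsX.
  apply: leq_trans (_ : _ <= #|arcs r C :|: setX (P :\: C) (P :\: C)|) _.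
    apply: subset_leq_card; apply/subsetP => -[u w]; rewrite !in_setU in_setX !in_setD in_set /= => uw.
    have [-> ->] := rP _ _ uw; rewrite !andbT inE /= uw andbT.
    case: (boolP (u \in C)) => uC; case: (boolP (w \in C)) => wC //=.
      by rewrite (component_edge uC uw) in wC.
    by rewrite rs in uw; rewrite (component_edge wC uw) in uC.
  exact: leq_card_setU.
have arcC : #|arcs r C| <= #|C| * #|C|.
  rewrite -cardsX; apply: subset_leq_card; apply/subsetP => z; rewrite !inE.
  by move=> /and3P[-> ->].
exists v; split=> //.
  case: (matching_or_cover v Q rs) => // -[a [b]]; rewrite -/C => -[ab1 ab2 ab3]; exfalso.
  move: big split arcC ab1 ab2 ab3 C2 CP QP PQ; clear.
  move: #|[set z | r z.1 z.2]| #|P| #|C| #|arcs r C| => A k c E.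
  move=> big split arcC ab1 ab2 ab3 C2 CP QP PQ.
  (* If [c > Q], the cover bound falls short by at least [(a - th) ^ 2]. If [c <= Q], even [c * c]
     arcs in the component are too few, because [c] lies between [k / 2] and [Q], where
     [x ^ 2 + (k - x) ^ 2] is increasing. *)
  case: (leqP c Q) => cQ; last first.
    pose th := c - Q; pose f := k - c.
    have cE : c = Q + th by rewrite /th subnKC // ltnW.
    have kE : k = Q + th + f by rewrite -cE /f subnKC.
    have fE : k - c = f by []. have gE : k - Q = th + f by rewrite kE; clear; lia.
    rewrite fE in split; rewrite gE in big; rewrite cE in ab3.
    have h1 : b * b <= (Q - 2 * a) * (Q - 2 * a) by apply: leq_mul; lia.
    pose s := Q - 2 * a; have QE : Q = 2 * a + s by rewrite /s subnKC //; lia.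
    rewrite -/s in h1; move: big split ab3 h1; rewrite QE; clear.
    have [+ _] := nat_AGM2 a th; rewrite -!mulnn; nia.
  pose dl := Q - c; pose e := k - Q.
  have QE : Q = c + dl by rewrite /dl subnKC.
  have kE : k = c + dl + e by rewrite -QE /e subnKC.
  have fE : k - c = dl + e by rewrite kE; clear; lia.
  rewrite fE in split; rewrite -/e in big.
  have : dl + e <= c by lia.
  by move: big split arcC; rewrite QE; clear; nia.
case: (boolP (connect _ _ _)) => // nb; have := bipartite_component_arcs rs nb.
rewrite -/C; move: big split C2 CP QP PQ; clear.
move: #|[set z | r z.1 z.2]| #|P| #|C| #|arcs r C| => A k c E big split C2 CP QP PQ bipE.
exfalso; pose f := k - c; have kE : k = c + f by rewrite /f subnKC.
pose e := k - Q; have kE' : k = Q + e by rewrite /e subnKC.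
rewrite -/f in split; rewrite -/e in big.
have fc : f <= c by lia.
have h1 : (c + f) * (c + f) <= 2 * (Q * Q + e * e).
  by rewrite -kE kE'; clear; have [+ _] := nat_AGM2 Q e; rewrite -!mulnn; nia.
have h2 : f * f <= c * f by apply: leq_mul.
by move: big split bipE h1 h2; clear; nia.
Qed.

(** * Partition into blocks with few irregular pairs *)

Definition equiblocks (T : finType) (P : {set {set T}}) (s : nat) : Prop :=
  trivIset P /\ forall B, B \in P -> #|B| = s.

Lemma card_equiblocks (T : finType) (P : {set {set T}}) (s : nat) :
  equiblocks P s -> #|cover P| = #|P| * s.
Proof. by move=> [/eqP <- Ps]; rewrite -sum_nat_const; apply: eq_bigr => B /Ps. Qed.

(** A maximal family of disjoint one-coloured blocks leaves at most [s] vertices of each colour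
    uncovered. *)
Lemma chop_into_blocks (T I : finType) (f : T -> I) (S : {set T}) (s : nat) :
  0 < s -> exists P : {set {set T}}, [/\ equiblocks P s,
    forall B, B \in P -> B \subset S,
    forall B x y, B \in P -> x \in B -> y \in B -> f x = f y &
    #|S| <= #|cover P| + #|I| * s].
Proof.
move=> s0.
pose okB (B : {set T}) := [&& B \subset S, #|B| == s & [forall x in B, forall y in B, f x == f y]].
pose ok (P : {set {set T}}) := trivIset P && [forall B in P, okB B].
have ok0 : ok set0.
  apply/andP; split; first by apply/trivIsetP => A B; rewrite in_set0.
  by apply/forall_inP => B; rewrite in_set0.
have [P /maxsetP[/andP[tP /forall_inP okP] max] _] := maxset_exists ok0.
exists P; split.
- by split=> // B /okP /and3P[_ /eqP].
- by move=> B /okP /and3P[].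
- by move=> B x y /okP /and3P[_ _ /forall_inP H] /H /forall_inP H' /H' /eqP.
have small i : #|[set x in S :\: cover P | f x == i]| <= s.
  rewrite leqNgt; apply/negP => /ltnW /subset_card_eq[B BS cB].
  have BSx x : x \in B -> [/\ x \in S, x \notin cover P & f x = i].
    by move/(subsetP BS); rewrite !inE => /andP[/andP[-> ->] /eqP].
  have BP : B \notin P.
    apply/negP => BP; have /card_gt0P[x xB] : 0 < #|B| by rewrite cB.
    by have [_ /negP[]] := BSx _ xB; apply/bigcupP; exists B.
  have okBP : ok (B |: P).
    apply/andP; split.
      apply/trivIsetP => A A'; rewrite !in_setU1.
      have dB C : C \in P -> [disjoint B & C].
        move=> CP; rewrite disjoints_subset; apply/subsetP => x /BSx[_ xP _].
        by rewrite in_setC; apply: contra xP => xC; apply/bigcupP; exists C.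
      move=> /predU1P[->|AP] /predU1P[->|A'P]; rewrite ?eqxx //.
      - by move=> _; apply: dB.
      - by move=> _; rewrite disjoint_sym; apply: dB.
      - exact: (trivIsetP tP).
    apply/forall_inP => C; rewrite in_setU1 => /predU1P[->|/okP//].
    rewrite /okB cB eqxx /=; apply/andP; split.
      by apply/subsetP => x /BSx[].
    apply/forall_inP => x /BSx[_ _ ->]; apply/forall_inP => y /BSx[_ _ ->].
    exact: eqxx.
  by move: BP; rewrite -(max _ okBP (subsetUr _ _)) in_setU1 eqxx.
have : #|S :\: cover P| <= #|I| * s.
  rewrite -sum1_card (partition_big f predT) //= -[leqRHS]sum_nat_const.
  rewrite [leqRHS](eq_bigl predT) //; apply: leq_sum => i _.
  apply: leq_trans (small i); rewrite -sum1_card leq_eqVlt; apply/orP; left; apply/eqP.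
  by apply: eq_bigl => x; rewrite [in RHS]inE.
have := cardsID (cover P) S; have := subset_leq_card (subsetIr S (cover P)).
by move: #|S :\: _| #|S :&: _| (#|I| * s) #|S| #|cover P|; clear; lia.
Qed.

Definition empty_pairs (T : finType) (G : sgraph T) (P : {set {set T}}) : {set T * T} :=
  [set z | [exists A in P, exists B in P,
             [&& z.1 \in A, z.2 \in B & edges_between G A B == 0]]].

Lemma empty_pairsP (T : finType) (G : sgraph T) (P : {set {set T}}) (z : T * T) :
  reflect (exists A B, [/\ A \in P, B \in P, z.1 \in A, z.2 \in B & edges_between G A B = 0])
          (z \in empty_pairs G P).
Proof.
rewrite inE; apply: (iffP exists_inP) => [[A AP /exists_inP[B BP /and3P[? ? /eqP]]]|].
  by exists A, B.
move=> [A [B [AP BP zA zB AB]]]; exists A => //; apply/exists_inP; exists B => //.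
by rewrite zA zB AB eqxx.
Qed.

Definition irregular_pairs (T : finType) (G : sgraph T) (m : nat) (P : {set {set T}}) :
    {set {set T} * {set T}} :=
  [set z | [&& z.1 \in P, z.2 \in P, 0 < edges_between G z.1 z.2 & ~~ joined G m z.1 z.2]].

(** The number of colours in [refine_blocks]: a set of blocks together with two sets of ordered
    pairs of blocks. *)
Definition refinement_cost (k : nat) : nat := 2 ^ (k + 2 * k ^ 2).

Lemma edges_between0S (T : finType) (G : sgraph T) (A B A' B' : {set T}) :
  A' \subset A -> B' \subset B -> edges_between G A B = 0 -> edges_between G A' B' = 0.
Proof.
move=> /subsetP AA /subsetP BB AB; apply/eqP; rewrite -leqn0 leqNgt; apply/negP.
case/edges_betweenP => x [y [xA yB xy]].
suff : 0 < edges_between G A B by rewrite AB.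
by apply/edges_betweenP; exists x, y; split; auto.
Qed.

Lemma trivIset_eq (T : finType) (P : {set {set T}}) (A B : {set T}) (x : T) :
  trivIset P -> A \in P -> B \in P -> x \in A -> x \in B -> A = B.
Proof.
by move=> tP AP BP xA xB; rewrite -(def_pblock tP AP xA) -(def_pblock tP BP xB).
Qed.

Lemma mem_setX (T1 T2 : finType) (A : {set T1}) (B : {set T2}) (z : T1 * T2) :
  (z \in setX A B) = (z.1 \in A) && (z.2 \in B).
Proof. by case: z => x y; rewrite in_setX. Qed.

(** An irregular pair has an edgeless witness with at least [m * m] vertex pairs; the witnesses are
    disjoint from one another and from the vertex pairs already counted. After refinement both kinds
    lie in edgeless pairs of blocks, except where an end is newly uncovered, which affects at most
    [2 * #|T|] pairs per uncovered vertex. *)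
Lemma refine_blocks (T : finType) (G : sgraph T) (P : {set {set T}}) (s m s' : nat) :
  equiblocks P s -> 0 < s' ->
  exists P' : {set {set T}}, [/\ equiblocks P' s',
    #|cover P| <= #|cover P'| + refinement_cost #|P| * s' &
    #|empty_pairs G P| + #|irregular_pairs G m P| * (m * m) <=
      #|empty_pairs G P'| + 2 * (#|T| * (refinement_cost #|P| * s'))].
Proof.
move=> [tP Ps] s0'.
pose good (z XY : {set T} * {set T}) := [&& XY.1 \subset z.1, XY.2 \subset z.2,
  m <= #|XY.1|, m <= #|XY.2| & edges_between G XY.1 XY.2 == 0].
pose wit (z : {set T} * {set T}) := odflt (set0, set0) [pick XY | good z XY].
have witP z : z \in irregular_pairs G m P -> good z (wit z).
  rewrite inE => /and4P[_ _ _ /forallPn[X /forallPn[Y]]].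
  rewrite negb_imply -eqn0Ngt => /andP[/and4P[XA YB mX mY] e0].
  rewrite /wit; case: pickP => [XY //|/(_ (X, Y))].
  by rewrite /good /= XA YB mX mY e0.
pose idx := 'I_#|P|; pose blk (i : idx) := enum_val i.
pose colour := ({set idx} * {set idx * idx} * {set idx * idx})%type.
(* The colour of a vertex lists its block and the witnesses containing it, so that
   blocks of constant colour refine both. *)
pose f x : colour :=
  ([set i | x \in blk i], [set z | x \in (wit (blk z.1, blk z.2)).1],
   [set z | x \in (wit (blk z.1, blk z.2)).2]).
have [P' [eP' P'S mono covP']] := chop_into_blocks f (cover P) s0'.
have cardf : #|{: colour}| = refinement_cost #|P|.
  rewrite !card_prod -!cardsT -!powersetT !card_powerset !cardsT card_prod !card_ord -!expnD.
  by rewrite /refinement_cost -mulnn; congr (2 ^ _); clear; lia.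
rewrite cardf in covP'.
exists P'; split=> //.
have inj A : A \in P -> exists i, blk i = A.
  by move=> AP; exists (enum_rank_in AP A); rewrite /blk enum_rankK_in.
have monoA B A x : B \in P' -> A \in P -> x \in B -> x \in A -> B \subset A.
  move=> BP' AP xB xA; have [i iA] := inj _ AP; apply/subsetP => y yB.
  have /(congr1 (fun u : colour => i \in u.1.1)) := mono _ _ _ BP' xB yB.
  by rewrite /= !inE iA xA => <-.
have mono1 B z x : B \in P' -> z \in irregular_pairs G m P -> x \in B ->
    x \in (wit z).1 -> B \subset (wit z).1.
  move=> BP' + xB xz; rewrite inE => /and4P[z1 z2 _ _]; apply/subsetP => y yB.
  have [i iA] := inj _ z1; have [j jA] := inj _ z2.
  have /(congr1 (fun u : colour => (i, j) \in u.1.2)) := mono _ _ _ BP' xB yB.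
  by rewrite /= !inE /= iA jA -surjective_pairing xz => <-.
have mono2 B z x : B \in P' -> z \in irregular_pairs G m P -> x \in B ->
    x \in (wit z).2 -> B \subset (wit z).2.
  move=> BP' + xB xz; rewrite inE => /and4P[z1 z2 _ _]; apply/subsetP => y yB.
  have [i iA] := inj _ z1; have [j jA] := inj _ z2.
  have /(congr1 (fun u : colour => (i, j) \in u.2)) := mono _ _ _ BP' xB yB.
  by rewrite /= !inE /= iA jA -surjective_pairing xz => <-.
pose F z := if z \in irregular_pairs G m P then setX (wit z).1 (wit z).2 else set0.
pose W := \bigcup_z F z.
have inF z t : t \in F z -> [/\ z \in irregular_pairs G m P, t.1 \in (wit z).1 & t.2 \in (wit z).2].
  by rewrite /F; case: ifP => // zi; rewrite ?in_set0 // mem_setX => /andP[].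
have inF' z t : t \in F z -> [/\ z.1 \in P, z.2 \in P, t.1 \in z.1, t.2 \in z.2 &
    0 < edges_between G z.1 z.2].
  move=> /inF[zi t1 t2]; have /and5P[s1 s2 _ _ _] := witP _ zi.
  move: zi; rewrite inE => /and4P[-> -> -> _]; split=> //.
    exact: (subsetP s1).
  exact: (subsetP s2).
have cardW : #|irregular_pairs G m P| * (m * m) <= #|W|.
  have dF z z' : z != z' -> [disjoint F z & F z'].
    apply: contraNT => /pred0Pn[t /andP[/= /inF'[z1 z2 t1 t2 _] /inF'[z1' z2' t1' t2' _]]].
    rewrite [z]surjective_pairing [z']surjective_pairing.
    by rewrite (trivIset_eq tP z1 z1' t1 t1') (trivIset_eq tP z2 z2' t2 t2').
  rewrite -[#|W|]sum1_card partition_disjoint_bigcup //= -sum_nat_const.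
  rewrite [leqRHS](bigID (mem (irregular_pairs G m P))) /=.
  apply: leq_trans (leq_addr _ _); apply: leq_sum => z zi.
  rewrite sum1_card /F zi cardsX; have /and5P[_ _ h1 h2 _] := witP _ zi.
  exact: leq_mul.
have dW : [disjoint empty_pairs G P & W].
  apply/pred0Pn => -[t /andP[/= /empty_pairsP[A [B [AP BP tA tB AB]]] /bigcupP[z _ /inF'[z1 z2 t1 t2 e]]]].
  by move: e; rewrite -(trivIset_eq tP AP z1 tA t1) -(trivIset_eq tP BP z2 tB t2) AB.
pose L := cover P :\: cover P'.
have covS : cover P' \subset cover P.
  by apply/bigcupsP => B /P'S.
have cardL : #|L| <= refinement_cost #|P| * s'.
  by rewrite /L cardsD (setIidPr covS) leq_subLR.
have sub : empty_pairs G P :|: W \subset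
    empty_pairs G P' :|: (setX L [set: T] :|: setX [set: T] L).
  apply/subsetP => t tU.
  have [A [B [X [Y [[AP BP] [tA tB] [tX tY] e0 [mX mY]]]]]] : exists A B X Y : {set T},
      [/\ A \in P /\ B \in P, t.1 \in A /\ t.2 \in B, t.1 \in X /\ t.2 \in Y,
          edges_between G X Y = 0 &
          (forall C, C \in P' -> t.1 \in C -> C \subset X) /\
          (forall C, C \in P' -> t.2 \in C -> C \subset Y)].
    move: tU; rewrite in_setU => /orP[/empty_pairsP[A [B [AP BP tA tB AB]]]|].
      by exists A, B, A, B; split=> //; split=> C CP' tC; apply: monoA CP' _ tC _.
    case/bigcupP => z _ zt; have [zi t1 t2] := inF _ _ zt; have [z1 z2 t1' t2' _] := inF' _ _ zt.
    have /and5P[_ _ _ _ /eqP e0] := witP _ zi.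
    exists z.1, z.2, (wit z).1, (wit z).2; split=> //; split=> C CP' tC.
      exact: mono1 CP' zi tC t1.
    exact: mono2 CP' zi tC t2.
  have tcA : t.1 \in cover P by apply/bigcupP; exists A.
  have tcB : t.2 \in cover P by apply/bigcupP; exists B.
  rewrite !in_setU !mem_setX !in_setT /L !in_setD tcA tcB andbT /=.
  case: (boolP (t.1 \in cover P')) => /=; last by rewrite orbT.
  case/bigcupP => C CP' tC; case: (boolP (t.2 \in cover P')) => /=; last by rewrite !orbT.
  case/bigcupP => D DP' tD; apply/orP; left; apply/empty_pairsP; exists C, D; split=> //.
  exact: edges_between0S (mX _ CP' tC) (mY _ DP' tD) e0.
have := subset_leq_card sub.
have /eqP -> : #|empty_pairs G P :|: W| == #|empty_pairs G P| + #|W|.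
  by rewrite (leq_card_setU _ _).2.
move=> le; apply: leq_trans (leq_trans _ le) _; first by rewrite leq_add2l.
apply: leq_trans (leq_card_setU _ _) _; rewrite leq_add2l.
apply: leq_trans (leq_card_setU _ _) _; rewrite !cardsX cardsT (mulnC #|L|) addnn -mul2n.
by rewrite leq_mul2l /= leq_mul2l cardL orbT.
Qed.

Lemma leq_refinement_cost (k K : nat) : k <= K -> refinement_cost k <= refinement_cost K.
Proof. by move=> kK; rewrite leq_exp2l // leq_add // leq_mul // leq_sqr. Qed.

Lemma card_empty_pairs (T : finType) (G : sgraph T) (P : {set {set T}}) :
  #|empty_pairs G P| <= #|T| * #|T|.
Proof. by rewrite -card_prod max_card. Qed.

(** More than [k ^ 2 / N] irregular pairs with witnesses of side at least [s / N] contribute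
    [n ^ 2 / (4 * N ^ 3)] vertex pairs, and the uncovered vertices cost at most half of that: every
    round gains [n ^ 2 / (8 * N ^ 3)]. *)
Lemma refinement_gain (N n k s c b E E' j : nat) :
  2 <= N -> k * k < N * b -> n <= 2 * (k * s) -> 16 * N ^ 4 * c <= n ->
  E + b * ((s %/ N).+1 * (s %/ N).+1) <= E' + 2 * (n * c) ->
  j * (n * n) <= 8 * N ^ 3 * E -> j.+1 * (n * n) <= 8 * N ^ 3 * E'.
Proof.
move=> N2 kb nks cn EE jE.
set m := (s %/ N).+1 in EE.
have sm : s <= m * N by rewrite /m ltnW // ltn_ceil //; apply: leq_trans N2.
have h1 : n * n <= 4 * (N ^ 3 * (b * (m * m))).
  have a1 : n * n <= (2 * (k * s)) * (2 * (k * s)) by apply: leq_mul.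
  have a2 : (k * s) * (k * s) <= (N * b) * ((m * N) * (m * N)).
    by rewrite mulnACA leq_mul // ?(ltnW kb) // leq_mul.
  rewrite (_ : N ^ 3 * (b * (m * m)) = (N * b) * ((m * N) * (m * N))).
    by move: a1 a2; clear; lia.
  by rewrite -[3]/(1 + 2) expnD expn1 -mulnn; clear; lia.
have h2 : 16 * (N ^ 3 * (n * c)) <= n * n.
  have : n * (16 * N ^ 4 * c) <= n * n by rewrite leq_mul2l cn orbT.
  apply: leq_trans; rewrite (_ : 16 * (N ^ 3 * (n * c)) = n * (16 * N ^ 3 * c)).
    by rewrite leq_mul2l leq_mul2r leq_mul2l leq_pexp2l ?orbT // (leq_trans _ N2).
  by clear; lia.
have h3 : N ^ 3 * E + N ^ 3 * (b * (m * m)) <= N ^ 3 * E' + 2 * (N ^ 3 * (n * c)).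
  by rewrite -mulnDr (mulnCA 2) -mulnDr leq_mul2l EE orbT.
rewrite mulSn; move: jE; rewrite -(mulnA 8) -(mulnA 8).
move: h1 h2 h3; clear.
move: (N ^ 3 * (b * (m * m))) (N ^ 3 * (n * c)) (N ^ 3 * E) (N ^ 3 * E') (n * n) (j * (n * n)).
by lia.
Qed.

(** The potential is at most [#|T| ^ 2], so fewer than [J] rounds can gain. Each uncovers at most
    [#|T| / (16 * N ^ 4)] vertices, which keeps the total loss below [#|T| / N]. In [main], [j]
    bounds the rounds left, and [K], [n1] are fixed before the graph is given. *)
Lemma regular_blocks (N k0 : nat) : 2 <= N -> 0 < k0 ->
  exists K n1, forall (T : finType) (G : sgraph T), n1 <= #|T| ->
  exists (P : {set {set T}}) (s : nat), [/\ equiblocks P s, 0 < s, k0 <= #|P| <= K,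
    N * (#|T| - #|P| * s) <= #|T| &
    N * #|irregular_pairs G (s %/ N).+1 P| <= #|P| * #|P|].
Proof.
move=> N2 k00.
have N0 : 0 < N by apply: leq_trans N2.
pose J := (8 * N ^ 3).+1; pose c0 := 16 * N ^ 4 * (2 * k0).
have N40 : 0 < 16 * N ^ 4 by rewrite muln_gt0 expn_gt0 N0.
have c00 : 0 < c0 by rewrite /c0 (muln_gt0 (16 * _)) (muln_gt0 2) N40 k00.
have N34 : 2 * (8 * N ^ 3) <= 8 * N ^ 4.
  by rewrite mulnCA leq_mul2l /= (expnS N 3) leq_mul2r N2 orbT.
have N38 : 8 <= N ^ 3 by rewrite -[8]/(2 ^ 3) leq_exp2r.
pose final (T : finType) (G : sgraph T) (K : nat) :=
  exists (P : {set {set T}}) (s : nat), [/\ equiblocks P s, 0 < s, k0 <= #|P| <= K,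
    N * (#|T| - #|P| * s) <= #|T| &
    N * #|irregular_pairs G (s %/ N).+1 P| <= #|P| * #|P|].
(* Divisibility of [M] by [k0 * 2] serves to give [M >= 2 * k0]. As the blocks cover at least half
   of the vertices, their number lies between [M / 2] and [2 * M]. *)
have blocks_number n M k s : 0 < n -> M = k0 * 2 * (M %/ (k0 * 2)) -> M <= n -> 0 < M ->
    s = n %/ M -> k * s <= n -> n <= 2 * (k * s) -> [/\ 0 < s, k0 <= k & k <= 2 * M].
  move=> n0 Mk Mn M0 sE ks nks.
  have s0 : 0 < s by rewrite sE divn_gt0.
  have sM : s * M <= n by rewrite sE leq_trunc_div.
  have ns : n < s.+1 * M by rewrite sE ltn_ceil.
  split=> //.
    have k0M : k0 * 2 <= M.
      rewrite Mk leq_pmulr //; move: M0; rewrite Mk muln_gt0.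
      by rewrite mulKn ?muln_gt0 ?k00 // => /andP[].
    rewrite -(leq_pmul2r s0); move: (leq_mul k0M (leqnn s)) sM nks; clear.
    by move: (k * s); nia.
  rewrite -(leq_pmul2r s0).
  have : s.+1 * M <= 2 * s * M by rewrite leq_mul2r; apply/orP; right; move: s0; clear; lia.
  by move: ks ns; rewrite (mulnAC 2 M); clear; lia.
have main j : j <= J -> forall K0, exists K n1, forall (T : finType) (G : sgraph T)
    (P : {set {set T}}) (s : nat), n1 <= #|T| -> equiblocks P s -> 0 < s ->
    k0 <= #|P| <= K0 -> 16 * N ^ 4 * (#|T| - #|P| * s) <= (J.+1 - j) * #|T| ->
    (J - j) * (#|T| * #|T|) <= 8 * N ^ 3 * #|empty_pairs G P| -> final T G K.
  elim: j => [|j IH] jJ K0.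
    (* With no round left the potential exceeds [#|T| ^ 2], a contradiction. The value 0 is a mere
       placeholder; 1 makes [T] nonempty. *)
    exists 0, 1 => T G P s n0 _ _ _ _.
    rewrite subn0 /J mulSn => H; exfalso.
    have : 8 * N ^ 3 * #|empty_pairs G P| <= 8 * N ^ 3 * (#|T| * #|T|).
      by rewrite leq_mul2l card_empty_pairs orbT.
    have : 0 < #|T| * #|T| by rewrite muln_gt0 n0.
    by move: H; clear; lia.
  pose M := refinement_cost K0 * c0.
  have M0 : 0 < M by rewrite muln_gt0 c00 expn_gt0.
  have [K [n1 H]] := IH (ltnW jJ) (2 * M).
  exists (maxn K K0), (maxn n1 M) => T G P s; rewrite geq_max => /andP[n1T MT] eP s0 /andP[kP PK] lo em.
  have n0 : 0 < #|T| by apply: leq_trans MT.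
  have ksn : #|P| * s <= #|T| by rewrite -(card_equiblocks eP) max_card.
  have lo1 : 16 * N ^ 4 * (#|T| - #|P| * s) <= (8 * N ^ 3).+1 * #|T|.
    by apply: leq_trans lo _; rewrite leq_mul2r subSS leq_subr orbT.
  have loN : N * (#|T| - #|P| * s) <= #|T|.
    have e1 : (8 * N ^ 3).+1 * #|T| <= 16 * N ^ 3 * #|T|.
      by rewrite leq_mul2r; apply/orP; right; move: N38; clear; lia.
    have N30 : 0 < 16 * N ^ 3 by rewrite muln_gt0 expn_gt0 N0.
    rewrite -(leq_pmul2l N30); apply: leq_trans e1; apply: leq_trans lo1.
    by rewrite mulnA -[X in X * _]mulnA -expnSr.
  case: (leqP (N * #|irregular_pairs G (s %/ N).+1 P|) (#|P| * #|P|)) => irr.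
    exists P, s; split=> //; rewrite kP /=; apply: leq_trans PK _; exact: leq_maxr.
  pose s' := #|T| %/ M; have s'0 : 0 < s' by rewrite divn_gt0.
  have [P' [eP' cP' eE]] := refine_blocks G (s %/ N).+1 eP s'0.
  have ksn' : #|P'| * s' <= #|T| by rewrite -(card_equiblocks eP') max_card.
  pose c := refinement_cost #|P| * s'.
  have cs : c0 * c <= #|T|.
    apply: leq_trans (_ : M * s' <= _); last by rewrite mulnC leq_trunc_div.
    by rewrite /M /c mulnA (mulnC c0) leq_mul // leq_mul // leq_refinement_cost.
  have cs1 : 16 * N ^ 4 * c <= #|T|.
    by apply: leq_trans cs; rewrite leq_mul2r leq_pmulr ?orbT // muln_gt0 k00.
  rewrite !(card_equiblocks eP) !(card_equiblocks eP') -/c in cP' eE.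
  have lo' : 16 * N ^ 4 * (#|T| - #|P'| * s') <= (J.+1 - j) * #|T|.
    apply: leq_trans (_ : 16 * N ^ 4 * (#|T| - #|P| * s) + 16 * N ^ 4 * c <= _).
      rewrite -mulnDr leq_mul2l; apply/orP; right; move: cP' ksn ksn'; clear.
      by move: (#|P| * s) (#|P'| * s'); lia.
    apply: leq_trans (leq_add lo cs1) _; rewrite -mulSnr leq_mul2r; apply/orP; right.
    by move: jJ; clear; lia.
  have n2 : #|T| <= 2 * (#|P| * s).
    have : 2 * (#|T| - #|P| * s) <= N * (#|T| - #|P| * s) by rewrite leq_mul2r N2 orbT.
    by move: loN ksn; clear; move: (#|P| * s); lia.
  have n2' : #|T| <= 2 * (#|P'| * s').
    have : 16 * N ^ 4 * (#|T| - #|P'| * s') <= 8 * N ^ 4 * #|T|.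
      apply: leq_trans lo' _; rewrite leq_mul2r; apply/orP; right.
      by move: N34 N38; rewrite /J; clear; lia.
    rewrite (_ : 16 * N ^ 4 = 8 * N ^ 4 * 2) -1?mulnA ?leq_pmul2l ?muln_gt0 ?expn_gt0 ?N0 //.
      by move: ksn'; clear; move: (#|P'| * s'); lia.
    by clear; lia.
  have [_ k0P' P'M] : [/\ 0 < s', k0 <= #|P'| & #|P'| <= 2 * M].
    apply: (blocks_number #|T|) => //.
    have Md : k0 * 2 %| M by rewrite mulnC; apply/dvdn_mull/dvdn_mull/dvdnn.
    by rewrite mulnC divnK.
  have em' : (J - j) * (#|T| * #|T|) <= 8 * N ^ 3 * #|empty_pairs G P'|.
    rewrite (_ : J - j = (J - j.+1).+1); last by move: jJ; clear; lia.
    exact: (refinement_gain N2 irr n2 cs1 eE em).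
  have [|P1 [t [h1 h2 /andP[h3 h4] h5 h6]]] := H T G P' s' n1T eP' s'0 _ lo' em'.
    by rewrite k0P' P'M.
  by exists P1, t; split=> //; rewrite h3 /=; apply: leq_trans h4 (leq_maxl _ _).
have [K [n1 H]] := main J (leqnn J) (2 * c0).
exists K, (maxn n1 c0) => T G; rewrite geq_max => /andP[n1T cT].
have n0 : 0 < #|T| by apply: leq_trans cT.
pose s := #|T| %/ c0; have s0 : 0 < s by rewrite divn_gt0.
have [P [eP _ _]] := chop_into_blocks (fun _ : T => tt) [set: T] s0.
rewrite cardsT card_unit mul1n (card_equiblocks eP) => cov.
have ksn : #|P| * s <= #|T| by rewrite -(card_equiblocks eP) max_card.
have sc : 16 * N ^ 4 * s <= #|T|.
  apply: leq_trans (_ : c0 * s <= _); last by rewrite mulnC leq_trunc_div.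
  by rewrite leq_mul2r leq_pmulr ?orbT // muln_gt0 k00.
have lo : #|T| - #|P| * s <= s by rewrite leq_subLR.
have lo' : 16 * N ^ 4 * (#|T| - #|P| * s) <= #|T|.
  by apply: leq_trans sc; rewrite leq_mul2l lo orbT.
have n2 : #|T| <= 2 * (#|P| * s).
  have : 2 * (#|T| - #|P| * s) <= 16 * N ^ 4 * (#|T| - #|P| * s).
    by rewrite leq_mul2r; apply/orP; right; move: N34 N38; clear; lia.
  by move: lo' ksn; clear; move: (#|P| * s); lia.
have [_ k0P PM] : [/\ 0 < s, k0 <= #|P| & #|P| <= 2 * c0].
  apply: (blocks_number #|T|) => //.
  have Md : k0 * 2 %| c0 by rewrite mulnC; apply/dvdn_mull/dvdnn.
  by rewrite mulnC divnK.
apply: (H T G P s) => //; first by rewrite k0P PM.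
  by rewrite subSnn mul1n.
by rewrite subnn mul0n.
Qed.

(** * The reduced graph *)

Lemma edges_between_sum (T : finType) (G : sgraph T) (U W : {set T}) :
  edges_between G U W = \sum_(x in U) \sum_(y in W) G x y.
Proof.
rewrite /edges_between -sum_degrees; apply: eq_bigr => x _.
by rewrite -sum1_card [RHS]big_mkcond [LHS]big_mkcond; apply: eq_bigr => y _; rewrite inE; case: (y \in W).
Qed.

Lemma edges_betweenC (T : finType) (G : sgraph T) (U W : {set T}) :
  edges_between G U W = edges_between G W U.
Proof.
rewrite !edges_between_sum exchange_big; apply: eq_bigr => x _.
by apply: eq_bigr => y _; rewrite adj_sym.
Qed.

Lemma edges_betweenS (T : finType) (G G' : sgraph T) (A B A' B' : {set T}) :
  subgraph G' G -> A' \subset A -> B' \subset B ->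
  edges_between G' A' B' <= edges_between G A B.
Proof.
move=> GG /subsetP AA /subsetP BB; apply: subset_leq_card; apply/subsetP => z.
by rewrite !inE => /and3P[/AA -> /BB -> /GG ->].
Qed.

Lemma edges_between_coverl (T : finType) (G : sgraph T) (P : {set {set T}}) (W : {set T}) :
  trivIset P -> edges_between G (cover P) W = \sum_(A in P) edges_between G A W.
Proof.
move=> tP; rewrite edges_between_sum big_trivIset //=.
by apply: eq_bigr => A _; rewrite edges_between_sum.
Qed.

Lemma edges_between_setC (T : finType) (G : sgraph T) (U W : {set T}) :
  edges_between G setT W = edges_between G U W + edges_between G (~: U) W.
Proof.
rewrite !edges_between_sum (bigID (mem U)) /=; congr (_ + _); apply: eq_bigl => x.
  by rewrite in_setT.
by rewrite in_setC in_setT.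
Qed.

Lemma edges_between_decomposition (T : finType) (G : sgraph T) (P : {set {set T}}) :
  trivIset P -> edges_between G setT setT =
    \sum_(A in P) \sum_(B in P) edges_between G A B +
    2 * (\sum_(A in P) edges_between G (~: cover P) A) +
    edges_between G (~: cover P) (~: cover P).
Proof.
move=> tP; rewrite (edges_between_setC _ (cover P)) edges_betweenC.
rewrite (edges_between_setC _ (cover P) (cover P)).
rewrite [edges_between G (~: _) setT]edges_betweenC (edges_between_setC _ (cover P) (~: cover P)).
rewrite [edges_between G (cover P) (~: _)]edges_betweenC.
have -> : edges_between G (cover P) (cover P) = \sum_(A in P) \sum_(B in P) edges_between G A B.
  rewrite edges_between_coverl //; apply: eq_bigr => A _.
  rewrite edges_betweenC edges_between_coverl //; apply: eq_bigr => B _.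
  by rewrite edges_betweenC.
have -> : edges_between G (~: cover P) (cover P) = \sum_(A in P) edges_between G (~: cover P) A.
  rewrite edges_betweenC edges_between_coverl //; apply: eq_bigr => A _.
  by rewrite edges_betweenC.
by clear; lia.
Qed.

Lemma nb_edges_le (T : finType) (G : sgraph T) :
  2 * nb_edges G <= edges_between G setT setT.
Proof.
rewrite /nb_edges /edges_between.
pose D := [set z : T * T | G z.1 z.2].
have -> : [set z | [&& z.1 \in [set: T], z.2 \in [set: T] & G z.1 z.2]] = D.
  by apply/setP => z; rewrite !inE.
rewrite -[#|D|]sum1_card (partition_big (fun z : T * T => [set z.1; z.2]) (mem (edges G))) /=; last first.
  by move=> z; rewrite inE => zG; apply/imsetP; exists z; rewrite ?inE.
rewrite mulnC -sum_nat_const; apply: leq_sum => e /imsetP[[x y]]; rewrite inE /= => xy ->.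
have nxy : (x, y) != (y, x).
  by apply: contraTneq xy => -[-> _]; rewrite adj_irrefl.
rewrite (bigD1 (x, y)) /=; last by rewrite inE xy eqxx.
by rewrite (bigD1 (y, x)) //= inE /= adj_sym xy setUC eqxx eq_sym nxy.
Qed.

(* A uniformly random [Z] separates each edge with probability 1/4. *)
Lemma exists_separating_set (T : finType) (G : sgraph T) (A B : {set T}) :
  exists Z : {set T}, edges_between G A B <= 4 * edges_between G (A :&: Z) (B :\: Z).
Proof.
pose D := [set z | [&& z.1 \in A, z.2 \in B & G z.1 z.2]].
have sep z : z \in D -> 2 ^ #|T| <= 4 * #|[set Z : {set T} | (z.1 \in Z) && (z.2 \notin Z)]|.
  case: z => x y; rewrite inE /= => /and3P[_ _ xy].
  have nxy : x != y by apply: contraTneq xy => ->; rewrite adj_irrefl.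
  have inj : {in powerset (~: [set x; y]) &, injective (fun Z : {set T} => x |: Z)}.
    move=> Z Z'; rewrite !powersetE => /subsetP ZX /subsetP ZX' /setP E; apply/setP => t.
    have := E t; rewrite !in_setU1; case: (eqVneq t x) => [-> _|_ //].
    have nin (Y : {set T}) : {subset Y <= ~: [set x; y]} -> (x \in Y) = false.
      by move=> H; apply/negP => /H; rewrite !inE eqxx.
    by rewrite !nin.
  have cT : #|T| = #|~: [set x; y]| + 2.
    by rewrite -(cardsC [set x; y]) cards2 nxy addnC.
  rewrite cT expnD mulnC leq_mul2l /= -card_powerset -(card_in_imset inj).
  apply: subset_leq_card; apply/subsetP => _ /imsetP[Z + ->]; rewrite powersetE => /subsetP ZX.
  rewrite inE setU11 in_setU1 negb_or eq_sym nxy /=; apply/negP => /ZX.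
  by rewrite !inE eqxx orbT.
have [/existsP[Z HZ]|/existsPn H] :=
    boolP [exists Z : {set T}, edges_between G A B <= 4 * edges_between G (A :&: Z) (B :\: Z)].
  by exists Z.
exfalso.
have big : 2 ^ #|T| * #|D| <= \sum_(Z : {set T}) 4 * edges_between G (A :&: Z) (B :\: Z).
  rewrite mulnC -sum_nat_const; apply: leq_trans (leq_sum _ sep) _.
  rewrite -!big_distrr /= leq_mul2l /=.
  under eq_bigr do rewrite -sum1_card.
  rewrite (exchange_big_dep predT) //=; apply: leq_sum => Z _.
  rewrite sum1_card; apply: subset_leq_card; apply/subsetP => z.
  by case/andP; rewrite !inE => /and3P[-> -> ->] /andP[-> ->].
have small : \sum_(Z : {set T}) (4 * edges_between G (A :&: Z) (B :\: Z) + 1) <=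
    \sum_(Z : {set T}) #|D|.
  by apply: leq_sum => Y _; rewrite addn1 ltnNge; apply: H.
have cS : #|{set T}| = 2 ^ #|T| by rewrite -!cardsT -powersetT card_powerset cardsT.
move: small big; rewrite big_split /= !sum_nat_const muln1 cS.
have : 0 < 2 ^ #|T| by rewrite expn_gt0.
move: (2 ^ #|T|) (2 ^ _ * _) (\sum_Z _) => a b c; clear; lia.
Qed.

Lemma pad_disjoint (T : finType) (U W : {set T}) (z : nat) :
  [disjoint U & W] -> #|U| + #|W| + 2 * z <= #|T| ->
  exists U' W' : {set T}, [/\ [disjoint U' & W'], U \subset U', W \subset W',
    z <= #|U'| <= #|U| + z & z <= #|W'| <= #|W| + z].
Proof.
move=> dUW le.
have cUW : #|U :|: W| <= #|U| + #|W| by apply: leq_card_setU.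
have [D D_sub cD] : exists2 D : {set T}, D \subset ~: (U :|: W) & #|D| = 2 * z.
  by apply: subset_card_eq; rewrite -[#|~: _|](addKn #|U :|: W|) cardsC; move: le cUW; clear; lia.
have [D1 D1D cD1] : exists2 D1 : {set T}, D1 \subset D & #|D1| = z.
  by apply: subset_card_eq; rewrite cD; clear; lia.
have cD2 : #|D :\: D1| = z by rewrite cardsD (setIidPr D1D) cD cD1; clear; lia.
have dDU : [disjoint D & U :|: W] by rewrite disjoints_subset.
move: (dDU); rewrite disjoint_setUr => /andP[dU dW].
have bd (X Y : {set T}) : #|Y| = z -> z <= #|X :|: Y| <= #|X| + z.
  by move=> <-; rewrite subset_leq_card ?subsetUr //=; apply: leq_card_setU.
exists (U :|: D1), (W :|: (D :\: D1)); split; rewrite ?subsetUl ?bd //.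
rewrite disjoint_setUl !disjoint_setUr dUW /=; apply/and3P; split.
- by rewrite disjoint_sym; apply: disjointWl dU; apply: subsetDl.
- exact: disjointWl D1D dW.
- by rewrite -setI_eq0 setIDA (setIidPl D1D) setDv.
Qed.

Definition reduced (T : finType) (G : sgraph T) (m : nat) (P : {set {set T}}) : rel {set T} :=
  fun A B => [&& A \in P, B \in P, A != B, 0 < edges_between G A B & joined G m A B].

Lemma reduced_sym (T : finType) (G : sgraph T) (m : nat) (P : {set {set T}}) :
  symmetric (reduced G m P).
Proof.
move=> A B; rewrite /reduced edges_betweenC eq_sym andbCA.
by congr [&& _, _, _, _ & _]; apply/idP/idP; apply: joined_sym.
Qed.

Lemma reduced_support (T : finType) (G : sgraph T) (m : nat) (P : {set {set T}}) :
  support_in (reduced G m P) P.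
Proof. by move=> A B /and5P[]. Qed.

(** * Assembling a cycle from a matching of the double cover *)

Lemma disjoint_family (T C : finType) (A : {set T}) (sz : C -> nat) :
  \sum_c sz c <= #|A| -> exists F : C -> {set T},
    [/\ forall c, F c \subset A, forall c, #|F c| = sz c &
        forall c c', c != c' -> [disjoint F c & F c']].
Proof.
move=> szA.
suff H (l : seq C) : uniq l -> forall A : {set T}, \sum_(c <- l) sz c <= #|A| ->
    exists F : C -> {set T}, [/\ forall c, c \in l -> F c \subset A,
      forall c, c \in l -> #|F c| = sz c &
      forall c c', c \in l -> c' \in l -> c != c' -> [disjoint F c & F c']].
  have [|F [FA cF dF]] := H (index_enum C) (index_enum_uniq _) A; first by [].
  by exists F; split=> [c|c|c c']; [apply: FA|apply: cF|apply: dF]; rewrite mem_index_enum.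
elim: l => [|x l IH] /= => [_ B _|/andP[xl ul] B]; first by exists (fun=> set0).
rewrite big_cons => le.
have [Y YB cY] : exists2 Y : {set T}, Y \subset B & #|Y| = sz x.
  by apply: subset_card_eq; apply: leq_trans le; apply: leq_addr.
have [|F [FB cF dF]] := IH ul (B :\: Y).
  by rewrite cardsD (setIidPr YB) cY leq_subRL // (leq_trans _ le) ?leq_addr.
have nx c : c \in l -> c != x by move=> cl; apply: contraNneq xl => <-.
have dY c : c \in l -> [disjoint Y & F c].
  move=> cl; rewrite disjoint_sym disjoints_subset; apply: subset_trans (FB c cl) _.
  exact: subsetDr.
exists (fun c => if c == x then Y else F c); split=> [c|c|c c'].
- rewrite inE => /predU1P[->|cl]; first by rewrite eqxx.
  by rewrite (negbTE (nx c cl)); apply: subset_trans (FB c cl) (subsetDl _ _).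
- rewrite inE => /predU1P[->|cl]; first by rewrite eqxx.
  by rewrite (negbTE (nx c cl)); apply: cF.
rewrite !inE => /predU1P[->|cl] /predU1P[->|cl']; rewrite ?eqxx //.
- by rewrite (negbTE (nx c' cl')) => _; apply: dY.
- by rewrite (negbTE (nx c cl)) => _; rewrite disjoint_sym; apply: dY.
- by rewrite (negbTE (nx c cl)) (negbTE (nx c' cl')); apply: dF.
Qed.

(** Greedy choice: the first part is as large as [lmax] permits while leaving 1 for every other
    part, and the parity condition makes it odd. *)
Lemma odd_composition (q n lmax : nat) :
  odd lmax -> odd n = odd q -> q <= n -> n <= q * lmax ->
  exists l : nat -> nat, (forall i, i < q -> odd (l i) /\ l i <= lmax) /\
                         \sum_(i < q) l i = n.
Proof.
move=> ol; elim: q n => [|q IH] n on qn nq.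
  by exists (fun=> 0); split=> //; rewrite big_ord0; move: nq; clear; lia.
pose x := minn lmax (n - q).
have ox : odd x.
  by rewrite /x; case: (leqP lmax (n - q)) => _ //; rewrite oddB ?on /= ?(ltnW qn) //; case: (odd q).
have xn : x <= n - q by apply: geq_minr.
have [||| l [ll ls]] := IH (n - x).
- by rewrite oddB ?ox ?on /= ?addbT ?negbK //; move: xn; clear; lia.
- by move: xn qn; clear; lia.
- move: nq; rewrite mulSn /x; case: (leqP lmax (n - q)) => H; first by clear; lia.
  move=> _; apply: (@leq_trans q); first by move: qn; clear; lia.
  by rewrite leq_pmulr // odd_gt0.
exists (fun i => if i is i'.+1 then l i' else x); split=> [[|i] iq|].
- by split=> //; apply: geq_minl.
- exact: ll.
- rewrite big_ord_recl /= ls subnKC //; by move: xn; clear; lia.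
Qed.

Lemma parity_path (I : finType) (r : rel I) (z : I * bool) (p : seq (I * bool)) :
  path (parity_rel r) z p -> odd (size p) = (z.2 != (last z p).2).
Proof.
elim: p z => [|x p IH] z /=; first by rewrite eqxx.
move=> /andP[/andP[_ zx] /IH ->]; move: zx.
by case: (z.2) (x.2) ((last x p).2) => [] [] [].
Qed.

(** The path is shortened only after a forced step to [a'], so that it has an edge even if [a = c].
    Since the nodes carry a parity, a block can be visited once with each parity, hence the bound
    [2 * #|P|]. *)
Lemma parity_walk (I : finType) (r : rel I) (P : {set I}) (a a' c : I * bool) :
  symmetric r -> support_in r P -> parity_rel r a a' -> connect (parity_rel r) a c ->
  exists w, [/\ path (parity_rel r) a (rcons w c), uniq w, size w <= 2 * #|P| &
    odd (size w).+1 = (a.2 != c.2)].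
Proof.
move=> rs rP aa' ac.
have a'c : connect (parity_rel r) a' c.
  apply: connect_trans ac; apply: connect1; by rewrite parity_rel_sym.
case/connectP: a'c => p0 /shortenP[p pp up _] cE {p0}.
have wE : rcons (belast a' p) c = a' :: p by rewrite cE -lastI.
exists (belast a' p); split.
- by rewrite wE /= aa'.
- by move: up; rewrite -wE rcons_uniq => /andP[].
- rewrite -ltnS -(size_rcons _ c) wE ltnW // ltnS.
  have sub : {subset a' :: p <= setX P [set: bool]}.
    move=> z zp; have [||y /andP[ryz _]] := @path_predecessor _ (parity_rel r) a z (a' :: p).
    - by rewrite /= aa'.
    - exact: zp.
    by rewrite mem_setX in_setT andbT; have [_ ->] := rP _ _ ryz.
  apply: leq_trans (uniq_leq_size up (s2 := enum (setX P [set: bool])) _) _.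
    by move=> z /sub; rewrite mem_enum.
  by rewrite -cardE cardsX cardsT card_bool mulnC.
- have : path (parity_rel r) a (a' :: p) by rewrite /= aa'.
  by move/parity_path; rewrite /= cE size_belast.
Qed.

(** Walks and trees contribute a total [S] of which only the parity can be prescribed. The path
    lengths are chosen afterwards as odd numbers with sum [t - S]; in the lower bound on [t], the
    term 4 in place of 3 leaves at least 1 for each of them. *)
Lemma cycle_in_component (T : finType) (G : sgraph T) (P : {set {set T}}) (s m D d q h lmax t : nat)
    (v : {set T}) :
  equiblocks P s -> 0 < m -> 2 <= D -> D ^ d.-1 <= m -> m <= D ^ d ->
  v \in P -> component_matching (reduced G m P) v q -> 0 < q ->
  (odd t -> connect (parity_rel (reduced G m P)) (v, false) (v, true)) ->
  odd lmax -> lmax + (8 * D + 33) * m <= 2 * h ->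
  2 * (2 * m + q * (2 * #|P|)) + 2 * h <= s ->
  q * (2 * d + 2 * #|P| + 4) <= t -> t <= q * lmax ->
  has_cycle G t.
Proof.
move=> [tP Ps] m0 D2 Dm mD vP [M [qM inj1 inj2 Mr]] q0 nbip olm lh sz tlo thi.
set r := reduced G m P in Mr nbip *.
have rs : symmetric r by apply: reduced_sym.
have rP : support_in r P by apply: reduced_support.
have psym := sym_connect_sym (parity_rel_sym rs).
pose w0 := 2 * m + q * (2 * #|P|).
(* [F A (true, b)] is the reserve of the node [(A, b)]; [F A (false, _)] are the
   halves of [A] used as first and second end of matching arcs. *)
have /fin_all_exists[F FP] : forall A : {set T}, exists F : bool * bool -> {set T},
    [/\ forall c, F c \subset A, forall c, A \in P -> #|F c| = if c.1 then w0 else h &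
        forall c c', c != c' -> [disjoint F c & F c']].
  move=> A.
  case: (boolP (A \in P)) => AP; last first.
    exists (fun=> set0); split=> // [c|c c' _]; first exact: sub0set.
    by rewrite -setI_eq0 setI0.
  have [|F [F1 F2 F3]] := @disjoint_family _ _ A (fun c : bool * bool => if c.1 then w0 else h).
    rewrite -(pair_big xpredT xpredT (fun a _ : bool => if a then w0 else h)) /= !big_bool /= Ps //.
    by move: sz; rewrite /w0; clear; lia.
  by exists F; split.
have dF A B c c' : A \in P -> B \in P -> (A, c) != (B, c') -> [disjoint F A c & F B c'].
  move=> AP BP; rewrite xpair_eqE negb_and.
  case: (eqVneq A B) => [<- /= cc'|AB _]; first by have [_ _] := FP A; apply.
  have [FA _ _] := FP A; have [FB _ _] := FP B.
  exact: disjointWl (FA _) (disjointWr (FB _) (trivIsetP tP _ _ AP BP AB)).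
pose W (z : {set T} * bool) := if z.1 \in P then F z.1 (true, z.2) else set0.
(* Arcs are oriented so that [(xs z, false)] and [(ys z, true)] can be reached from
   [(v, false)], even if the component is bipartite. *)
pose o (z : {set T} * {set T}) := connect (parity_rel r) (v, false) (z.1, false).
pose xs z := if o z then z.1 else z.2.
pose ys z := if o z then z.2 else z.1.
pose Xs z := if o z then F z.1 (false, false) else F z.2 (false, true).
pose Ys z := if o z then F z.2 (false, true) else F z.1 (false, false).
have XYs z : Xs z :|: Ys z = F z.1 (false, false) :|: F z.2 (false, true).
  by rewrite /Xs /Ys; case: ifP => // _; rewrite setUC.
have zP z : z \in M -> [/\ z.1 \in P, z.2 \in P & r (xs z) (ys z)].
  move=> /Mr[rz _]; have [h1 h2] := rP _ _ rz; split=> //.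
  by rewrite /xs /ys; case: ifP => // _; rewrite rs.
have reach z : z \in M -> connect (parity_rel r) (v, false) (xs z, false) /\
    connect (parity_rel r) (v, false) (ys z, true).
  move=> zM; have [_ _ rxy] := zP z zM.
  suff H : connect (parity_rel r) (v, false) (xs z, false).
    split=> //; apply: connect_trans H (connect1 _).
    by rewrite /parity_rel /= rxy.
  have [rz zC] := Mr z zM; rewrite /xs; case: ifP => //; rewrite /o => no.
  have [[] H] := parity_connect_exists zC; last by rewrite H in no.
  by apply: connect_trans H (connect1 _); rewrite /parity_rel /= rz.
pose ms := take q (enum M).
have sms : size ms = q by rewrite size_takel // -cardE.
have ums : uniq ms by rewrite take_uniq // enum_uniq.
(* Indices modulo [q] make link [q] equal to link 0, which closes the chain; [z0] is only the
   default of [nth]. *)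
pose z0 : {set T} * {set T} := (v, v).
pose zs i := nth z0 ms (i %% q).
have zsM i : zs i \in M.
  rewrite -mem_enum; apply: (@mem_take q); rewrite -/ms; apply: mem_nth.
  by rewrite sms ltn_mod.
(* A walk from parity [true] to parity [false] has an odd number of edges, so with an odd path
   length each link adds an even number. For odd [t] the one walk that returns to link 0 ends at
   parity [true] instead, by means of an odd closed walk at [v]. *)
pose x i := (xs (zs i), (i %% q == 0) && odd t).
pose y i := (ys (zs i), true).
have walks i : exists w, [/\ path (parity_rel r) (y i) (rcons w (x i.+1)), uniq w,
    size w <= 2 * #|P| & odd (size w).+1 = (true != (x i.+1).2)].
  have [_ _ rxy] := zP _ (zsM i).
  apply: (@parity_walk _ r P (y i) (xs (zs i), false) (x i.+1)) => //.
    by rewrite /parity_rel /= rs rxy.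
  have [_ ry] := reach _ (zsM i); have [rx _] := reach _ (zsM i.+1).
  apply: (@connect_trans _ _ (v, false)); first by rewrite psym.
  rewrite /x; case: (boolP (_ && _)) => //= /andP[_ /nbip nb].
  by apply: connect_trans nb _; apply: (parity_connect_flip rx).
have /fin_all_exists[w wP] := fun i : 'I_q => walks i.
pose w' i := if insub i is Some j then w j else [::].
have w'E (i : 'I_q) : w' i = w i by rewrite /w' valK.
pose S := \sum_(i < q) (2 * d + 2 + size (w' i) + 1).
have SE : S <= q * (2 * d + 2 * #|P| + 3).
  rewrite /S -[leqRHS](_ : \sum_(i < q) (2 * d + 2 * #|P| + 3) = _).
    apply: leq_sum => i _; rewrite w'E; have [_ _ + _] := wP i.
    by clear; lia.
  by rewrite sum_nat_const card_ord.
have oS : odd S = odd q (+) odd t.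
  pose c (i : nat) := ((i %% q == 0) && odd t).
  have -> : odd S = odd (\sum_(i < q) (1 + c i.+1)).
    rewrite /S; move: (wP); clear -w'E x; move=> wP.
    elim/big_ind2: _ => // [a b a' b' e1 e2|i _]; first by rewrite !oddD e1 e2.
    rewrite -addnA oddD w'E addn1; have [_ _ _ ->] := wP i.
    by rewrite oddD oddM /= -/(c i.+1); case: (c i.+1).
  rewrite big_split /= sum_nat_const card_ord muln1 oddD; congr (_ (+) _).
  rewrite -(prednK q0) big_ord_recr /= prednK // {2}/c modnn eqxx /=.
  rewrite big1 ?add0n ?oddb // => i _.
  rewrite /c modn_small //; last by have := ltn_ord i; move: q0; clear; lia.
have tS : odd (t - S) = odd q.
  rewrite oddB ?oS; first by case: (odd t); case: (odd q).
  by move: SE tlo; clear; nia.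
have [||l [ll ls]] := @odd_composition q (t - S) lmax olm tS.
- by move: SE tlo; clear; nia.
- by apply: leq_trans (leq_subr _ _) thi.
have tE : t = \sum_(i < q) (2 * d + l i + 2 + size (w' i) + 1).
  rewrite -(subnKC (_ : S <= t)); last by move: SE tlo; clear; nia.
  by rewrite -ls /S -big_split /=; apply: eq_bigr => i _; clear; lia.
rewrite tE.
have idx i : i < q -> i %% q = i by apply: modn_small.
apply: (@cycle_of_links _ _ G m D d h q (2 * #|P|) (parity_rel r) (fun z => z.1) W x y
    (fun i => Xs (zs i)) (fun i => Ys (zs i)) l w') => //.
- by move=> i j /andP[/and5P[]].
- move=> i; rewrite /W; case: ifP => _; last exact: sub0set.
  by have [] := FP i.1.
- move=> [A b] [B c] ij; rewrite /W /=; case: ifP => iP; last by rewrite -setI_eq0 set0I.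
  case: ifP => jP; last by rewrite -setI_eq0 setI0.
  by apply: dF => //; apply: contraNneq ij => -[-> ->].
- move=> i j /andP[rij _]; have [_ jP] := rP _ _ rij.
  by rewrite /W jP; have [_ -> //] := FP j.1.
- move=> i _; have [z1 z2 _] := zP _ (zsM i).
  have [s1 c1 _] := FP (zs i).1; have [s2 c2 _] := FP (zs i).2.
  by rewrite /Xs /Ys /x /y /xs /ys /=; case: ifP => _; split; rewrite ?c1 ?c2.
- move=> i _; have [z1 z2 rxy] := zP _ (zsM i); split.
    by move: rxy => /and5P[].
  by rewrite /Xs /Ys; case: ifP => _; apply: dF; rewrite ?xpair_eqE ?andbF.
- move=> i j iq jq ij; rewrite !XYs.
  have [i1 i2 _] := zP _ (zsM i); have [j1 j2 _] := zP _ (zsM j).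
  have zij : zs i != zs j by rewrite /zs !idx // nth_uniq ?sms.
  have n1 : (zs i).1 != (zs j).1 by apply: contraNneq zij => /inj1 ->.
  have n2 : (zs i).2 != (zs j).2 by apply: contraNneq zij => /inj2 ->.
  by rewrite disjoint_setUl !disjoint_setUr !dF // xpair_eqE ?andbF // negb_and ?n1 ?n2.
- move=> i j _; rewrite XYs /W; have [i1 i2 _] := zP _ (zsM i).
  case: ifP => jP; last by rewrite -setI_eq0 setI0.
  by rewrite disjoint_setUl !dF // xpair_eqE /= ?andbF.
- move=> i iq; have := wP (Ordinal iq); rewrite -w'E /=.
  by case.
- move=> i iq; have [oi li] := ll i iq; split=> //.
  by apply: leq_trans lh; rewrite leq_add2r.
- by rewrite /x /zs modnn mod0n.
Qed.

Lemma component_matching_le (I : finType) (r : rel I) (v : I) (q Q : nat) :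
  q <= Q -> component_matching r v Q -> component_matching r v q.
Proof. by move=> qQ [M [QM ? ? ?]]; exists M; split=> //; apply: leq_trans QM. Qed.

(** A single arc serves [t <= L]; all [Q] arcs serve larger [t], where the bound of the fixed costs
    by [L] makes them affordable. Of the coefficient [8 * D + 40], the paths and trees take
    [8 * D + 33] and the reserves 4; the remaining [3 * m] cover the rounding of [L] to an odd
    number and of [s] to an even one. *)
Lemma cycle_up_to_capacity (T : finType) (G : sgraph T) (P : {set {set T}})
    (s m D K Q L t : nat) (v : {set T}) :
  equiblocks P s -> 0 < m -> 2 <= D -> v \in P -> #|P| <= K ->
  component_matching (reduced G m P) v Q -> 0 < Q -> Q <= #|P| ->
  (odd t -> connect (parity_rel (reduced G m P)) (v, false) (v, true)) ->
  L + (8 * D + 40) * m + 4 * (K * K) <= s ->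
  K * (2 * up_log D m + 2 * K + 4) <= L ->
  2 * up_log D m + 2 * K + 4 <= t -> t <= Q * L -> has_cycle G t.
Proof.
move=> eP m0 D2 vP PK cm Q0 QP nbip Ls CL tlo thi.
set d := up_log D m in CL tlo.
have mD : m <= D ^ d by apply: up_logP.
have Dm : D ^ d.-1 <= m.
  case: (leqP m 1) => m1; last by have /andP[/ltnW] := up_log_bounds D2 m1.
  by rewrite /d (_ : m = 1) ?up_log1 //; apply/eqP; rewrite eqn_leq m1.
suff link q : 0 < q -> q <= Q -> q * (2 * d + 2 * #|P| + 4) <= t -> t <= q * L -> has_cycle G t.
  case: (leqP t L) => tL.
    apply: (link 1) => //; rewrite ?mul1n //.
    by apply: leq_trans tlo; rewrite leq_add2r leq_add2l leq_mul2l PK.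
  apply: (link Q) => //; apply: leq_trans (ltnW tL); apply: leq_trans CL.
  apply: leq_mul; first exact: leq_trans PK.
  by rewrite leq_add2r leq_add2l leq_mul2l PK.
move=> q0 qQ qlo qhi.
have qK : q * (2 * #|P|) <= 2 * (K * K).
  rewrite mulnCA leq_mul2l /= leq_mul //; apply: leq_trans PK; exact: leq_trans QP.
pose w0 := 2 * m + q * (2 * #|P|).
pose lmax := L + ~~ odd L; pose h := s %/ 2 - w0.
have s2 : s <= 2 * (s %/ 2) + 1 by have := divn_eq s 2; have := ltn_pmod s (isT : 0 < 2); clear; lia.
have s2' : 2 * (s %/ 2) <= s by rewrite mulnC leq_trunc_div.
have w0s : w0 <= s %/ 2.
  by move: Ls qK s2 m0; rewrite /w0 mulnDl; clear; move: (q * _) (8 * D * m) (K * K) (s %/ 2); lia.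
apply: (@cycle_in_component _ G P s m D d q h lmax t v) => //.
- exact: component_matching_le cm.
- by rewrite /lmax oddD; case: (odd L).
- have := leq_b1 (~~ odd L); rewrite /lmax /h; move: w0s Ls qK s2 m0; rewrite /w0 !mulnDl; clear.
  by move: (q * _) (8 * D * m) (K * K) (s %/ 2) (nat_of_bool _); lia.
- by rewrite -/w0 /h; move: w0s s2'; clear; move: (s %/ 2); lia.
- by apply: leq_trans qhi _; rewrite leq_mul2l leq_addr orbT.
Qed.

(** From [d * d <= 8 * 2 ^ d.-1 <= 8 * n] follows [(c * d) ^ 2 <= 8 * c ^ 2 * n <= n ^ 2]. *)
Lemma up_log_small (D m n c : nat) : 2 <= D -> 0 < m -> m <= n -> 8 * (c * c) <= n ->
  c * up_log D m <= n.
Proof.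
move=> D2 m0 mn cn; set d := up_log D m.
have Dm : D ^ d.-1 <= n.
  apply: leq_trans mn; case: (leqP m 1) => m1; last by have /andP[/ltnW] := up_log_bounds D2 m1.
  by rewrite /d (_ : m = 1) ?up_log1 //; apply/eqP; rewrite eqn_leq m1.
have sq (e : nat) : e * e <= 8 * 2 ^ e.-1.
  case: e => // e; elim: e => // e IH /=; rewrite expnS /=.
  have {}IH : e.+1 * e.+1 <= 8 * 2 ^ e := IH.
  case: (leqP e 1) => e1; first by case: e e1 IH => [|[|]].
  by move: (2 ^ e) IH e1 => y; clear; nia.
have dd : d * d <= 8 * n.
  apply: leq_trans (sq d) _; rewrite leq_mul2l /=; apply: leq_trans Dm.
  by case: (d.-1) => // e; rewrite leq_exp2r.
by rewrite leqNgt; apply/negP => H; move: dd cn H; clear; nia.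
Qed.

(** * Densities *)

Local Open Scope ring_scope.

(** Handles overlapping and small sets: the separating set costs the factor 4, padding the summand
    [z]. Such a crude bound is enough for a block with itself and for the uncovered vertices. *)
Lemma upper_uniform_any (R : realType) (T : finType) (G : sgraph T) (p eta : R)
    (A B : {set T}) (z : nat) :
  0 < p -> 0 < eta -> upper_uniform p eta G -> eta * #|T|%:R <= z%:R ->
  (#|A| + #|B| + 2 * z <= #|T|)%N ->
  (edges_between G A B)%:R <= 4 * ((1 + eta) * p * (#|A| + z)%:R * (#|B| + z)%:R).
Proof.
move=> p0 e0 uu ez le; have [Z HZ] := exists_separating_set G A B.
have sA : A :&: Z \subset A by apply: subsetIl.
have sB : B :\: Z \subset B by apply: subsetDl.
have dAB : [disjoint A :&: Z & B :\: Z].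
  by rewrite disjoints_subset; apply/subsetP => x; rewrite !inE => /andP[_ ->].
have [|U [W [dUW AU BW /andP[zU Uz] /andP[zW Wz]]]] := @pad_disjoint _ _ _ z dAB.
  apply: leq_trans le; rewrite leq_add2r leq_add // subset_leq_card //.
have U1 : (#|U| <= #|A| + z)%N by apply: leq_trans Uz _; rewrite leq_add2r subset_leq_card.
have W1 : (#|W| <= #|B| + z)%N by apply: leq_trans Wz _; rewrite leq_add2r subset_leq_card.
apply: (@le_trans _ _ (4 * edges_between G (A :&: Z) (B :\: Z))%:R); first by rewrite ler_nat.
rewrite natrM ler_pM2l ?ltr0n //.
apply: (@le_trans _ _ (edges_between G U W)%:R).
  by rewrite ler_nat; apply: edges_betweenS AU BW => x y.
apply: le_trans (uu U W dUW _ _) _.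
- by apply: le_trans ez _; rewrite ler_nat.
- by apply: le_trans ez _; rewrite ler_nat.
have ep : 0 <= (1 + eta) * p by rewrite mulr_ge0 // ?ltW // ?addr_gt0.
apply: ler_pM; rewrite ?ler_nat ?ler0n //; first by rewrite mulr_ge0.
by apply: ler_wpM2l; rewrite ?ler_nat.
Qed.

(** An arc of the reduced graph carries at most [(1 + eta) * p * s ^ 2] edges. The rest, counted in
    units of [p * n ^ 2 / N], is 1 for irregular pairs, 16 for single blocks, 32 for uncovered
    vertices against blocks and 16 among themselves. The factor [1 + eta <= 9 / 8] and the excess of
    the main term keep the sum below 110. *)
Lemma reduced_density (R : realType) (T : finType) (G G' : sgraph T) (p eta : R)
    (P : {set {set T}}) (N s m : nat) :
  0 < p -> 0 < eta -> upper_uniform p eta G -> subgraph G' G ->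
  (8 <= N)%N -> N%:R * eta <= 1 -> eta * #|T|%:R <= s%:R ->
  equiblocks P s -> (N <= #|P|)%N -> (N * (#|T| - #|P| * s) <= #|T|)%N ->
  (N * #|irregular_pairs G' m P| <= #|P| * #|P|)%N ->
  (2 * nb_edges G')%:R <=
    p * (#|[set z | reduced G' m P z.1 z.2]|%:R * s%:R ^+ 2 + 110 * (#|T|%:R ^+ 2 / N%:R)).
Proof.
move=> p0 e0 uu GG N8 Ne es eP NP loN irrN.
have [tP Ps] := eP; have ksE := card_equiblocks eP.
set r := reduced G' m P; set irr := irregular_pairs G' m P in irrN *.
pose n := #|T|; pose k := #|P|; pose V0 := ~: cover P; pose lo := (n - k * s)%N.
have loE : #|V0| = lo by rewrite -(addKn #|cover P| #|V0|) cardsC ksE.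
have ksn : (k * s <= n)%N by rewrite -ksE max_card.
have Nsn : (N * s <= n)%N by apply: leq_trans ksn; rewrite leq_mul2r NP orbT.
rewrite -/n -/k -/lo in loN irrN es *.
pose q := (1 + eta) * p.
have q0 : 0 < q by rewrite mulr_gt0 // addr_gt0.
have up (A B : {set T}) : (edges_between G' A B)%:R <= (edges_between G A B)%:R :> R.
  by rewrite ler_nat; apply: edges_betweenS.
have weak (A B : {set T}) : (#|A| + #|B| + 2 * s <= n)%N ->
    (edges_between G' A B)%:R <= 4 * (q * (#|A| + s)%:R * (#|B| + s)%:R).
  by move=> le; apply: le_trans (up A B) (upper_uniform_any p0 e0 uu es le).
have N4s : (4 * s <= n)%N by move: Nsn N8; clear; nia.
have N4lo : (2 * lo + 2 * s <= n)%N by move: Nsn loN N8; clear; nia.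
have pair A B : A \in P -> B \in P -> (edges_between G' A B)%:R <=
    q * s%:R ^+ 2 * ((r A B)%:R + ((A, B) \in irr)%:R) + (A == B)%:R * (16 * (q * s%:R ^+ 2)).
  move=> AP BP; case: (eqVneq A B) => [<-|AB].
    have w := weak A A; rewrite !Ps // in w.
    rewrite mul1r; apply: le_trans (w _) _; first by move: N4s; clear; lia.
    rewrite -[leLHS]add0r lerD //.
      by rewrite mulr_ge0 ?addr_ge0 ?ler0n // mulr_ge0 ?exprn_ge0 ?ler0n // ltW.
    by rewrite natrD le_eqVlt; apply/orP; left; apply/eqP; ring.
  rewrite mul0r addr0; case: (posnP (edges_between G' A B)) => [->|eAB].
    by rewrite mulr_ge0 ?addr_ge0 ?ler0n // mulr_ge0 ?exprn_ge0 ?ler0n // ltW.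
  have -> : (r A B)%:R + ((A, B) \in irr)%:R = 1 :> R.
    rewrite /r /reduced AP BP AB eAB inE /= AP BP eAB /=.
    by case: (joined _ _ _ _); rewrite ?addr0 ?add0r.
  rewrite mulr1; apply: le_trans (up A B) _.
  have := uu A B (trivIsetP tP _ _ AP BP AB).
  by rewrite !Ps // expr2 mulrA; apply.
have main : (2 * nb_edges G')%:R <= q * s%:R ^+ 2 * (#|[set z | r z.1 z.2]|%:R + #|irr|%:R) +
   16 * (q * s%:R ^+ 2) * k%:R + 2 * (k%:R * (4 * (q * (lo + s)%:R * (2 * s)%:R))) +
   4 * (q * (lo + s)%:R * (lo + s)%:R).
  apply: (@le_trans _ _ (edges_between G' setT setT)%:R); first by rewrite ler_nat nb_edges_le.
  rewrite (edges_between_decomposition G' tP) 2!natrD natrM.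
  apply: lerD; first apply: lerD.
  - rewrite natr_sum (eq_bigr (fun A => \sum_(B in P) (edges_between G' A B)%:R)); last first.
      by move=> A _; rewrite natr_sum.
    apply: (@le_trans _ _ (\sum_(A in P) \sum_(B in P) (q * s%:R ^+ 2 *
        ((r A B)%:R + ((A, B) \in irr)%:R) + (A == B)%:R * (16 * (q * s%:R ^+ 2))))).
      by apply: ler_sum => A AP; apply: ler_sum => B BP; apply: pair.
    rewrite (eq_bigr (fun A => q * s%:R ^+ 2 * (\sum_(B in P) ((r A B)%:R + ((A, B) \in irr)%:R)) +
      16 * (q * s%:R ^+ 2))); last first.
      move=> A AP; rewrite big_split /= -mulr_sumr; congr (_ + _).
      rewrite -mulr_suml (bigD1 A) //= eqxx big1 ?addr0 ?mul1r // => B /andP[_ BA].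
      by rewrite eq_sym (negbTE BA).
    rewrite big_split /= -mulr_sumr sumr_const -/k mulr_natr lerD2r.
    apply: ler_wpM2l; first by rewrite mulr_ge0 ?exprn_ge0 ?ler0n // ltW.
    under eq_bigr do rewrite big_split /=.
    have cnt (e : rel {set T}) (D : {set {set T} * {set T}}) :
        (forall A B, A \in P -> B \in P -> e A B = ((A, B) \in D)) ->
        \sum_(A in P) \sum_(B in P) (e A B)%:R <= #|D|%:R :> R.
      move=> eD; rewrite pair_big_dep /= -sum1_card natr_sum.
      rewrite big_mkcond [leRHS]big_mkcond /=; apply: ler_sum => -[A B] _ /=.
      case: (boolP (A \in P)) => AP /=; last by case: ifP.
      case: (boolP (B \in P)) => BP /=; last by case: ifP.
      by rewrite eD //; case: ifP.
    rewrite big_split /=; apply: lerD; apply: cnt => A B _ _ //.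
    by rewrite inE.
  - rewrite ler_pM2l // natr_sum mulr_natl -sumr_const; apply: ler_sum => A AP.
    have w := weak V0 A; rewrite loE Ps // in w; apply: le_trans (w _) _.
      by move: N4lo N4s; clear; lia.
    by rewrite addnn mul2n.
  - have w := weak V0 V0; rewrite loE in w; apply: w.
    by move: N4lo; clear; lia.
apply: le_trans main _; rewrite -/n.
have aK : (#|[set z | r z.1 z.2]| <= k * k)%N.
  rewrite -cardsX; apply: subset_leq_card; apply/subsetP => z.
  by rewrite !inE => /and5P[-> -> _ _ _].
rewrite natrD natrM.
move: q0 ksn Nsn loN irrN aK Ne N8; rewrite -!(ler_nat R) !natrM /q.
move: (#|[set z | r z.1 z.2]|%:R : R) (ler0n R #|[set z | r z.1 z.2]|) (#|irr|%:R : R) (k%:R : R) (ler0n R k) (lo%:R : R) (ler0n R lo).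
move: (s%:R : R) (ler0n R s) (n%:R : R) (ler0n R n) (N%:R : R) p0 e0; clear.
move=> S S0 n n0 N p0 e0 a a0 i K K0 L L0 q0 KS NS NL Ni aK Ne N8.
pose u := n ^+ 2 / N.
have N0 : 0 < N by apply: lt_le_trans N8.
have uP x : N * x <= n ^+ 2 -> x <= u by move=> H; rewrite ler_pdivlMr // mulrC.
have nS : n * S <= u by apply: uP; rewrite mulrCA expr2; apply: ler_wpM2l.
have nL : n * L <= u by apply: uP; rewrite mulrCA expr2; apply: ler_wpM2l.
have Sn : S <= n.
  by apply: le_trans NS; rewrite ler_peMl //; apply: le_trans N8; lra.
have Ln : L <= n.
  by apply: le_trans NL; rewrite ler_peMl //; apply: le_trans N8; lra.
have KS2 : (K * S) ^+ 2 <= n ^+ 2 by rewrite ler_sqr // nnegrE mulr_ge0.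
have b1 : S ^+ 2 * i <= u.
  apply: uP; apply: le_trans KS2; rewrite mulrCA exprMn mulrC (expr2 K).
  by apply: ler_wpM2r; rewrite ?exprn_ge0.
have b2 : K * S * S <= u by apply: le_trans nS; apply: ler_wpM2r.
have b3 : K * S * L <= u by apply: le_trans nL; apply: ler_wpM2r.
have b4 : L * L <= u by apply: le_trans nL; apply: ler_wpM2r.
have b5 : S * L <= u by apply: le_trans nL; apply: ler_wpM2r.
have b6 : S * S <= u by apply: le_trans nS; apply: ler_wpM2r.
have u0 : 0 <= u by rewrite mulr_ge0 ?exprn_ge0 // invr_ge0 ltW.
have e8 : eta * 8 <= 1 by apply: le_trans Ne; rewrite mulrC; apply: ler_wpM2r; rewrite // ltW.
have b7 : eta * (S ^+ 2 * a) <= u.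
  apply: uP; apply: (@le_trans _ _ (1 * n ^+ 2)); last by rewrite mul1r.
  rewrite mulrA; apply: ler_pM => //; first by rewrite mulr_ge0 // ltW.
    by rewrite mulr_ge0 ?exprn_ge0.
  apply: le_trans KS2; rewrite mulrC exprMn; apply: ler_wpM2r; rewrite ?exprn_ge0 //.
pose X := S ^+ 2 * a + S ^+ 2 * i + 16 * (K * S * S) + 16 * (K * S * L + K * S * S) +
  4 * (L * L + 2 * (S * L) + S * S).
have XE : X <= S ^+ 2 * a + 65 * u by rewrite /X; clear - b1 b2 b3 b4 b5 b6; lra.
have -> : (1 + eta) * p * S ^+ 2 * (a + i) + 16 * ((1 + eta) * p * S ^+ 2) * K +
   2 * (K * (4 * ((1 + eta) * p * (L + S) * (2 * S)))) +
   4 * ((1 + eta) * p * (L + S) * (L + S)) = p * (X + eta * X) by rewrite /X; ring.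
rewrite ler_pM2l // -/u.
have eX : eta * X <= eta * (S ^+ 2 * a) + 65 * (eta * u).
  by rewrite (mulrCA 65) -mulrDr ler_pM2l.
have eu : eta * 8 * u <= u by rewrite ler_piMl.
by rewrite (mulrC a); move: XE eX eu b7 u0; clear; lra.
Qed.

(** As [g0 <= 1] and [beta < 1 / 4], the product [(g0 + beta) * (1 - beta / 2)] is at least
    [g0 + 3 * beta / 8]. Replacing [n * (n - 1)] by [n ^ 2] and dropping [110 / N] cost [beta / 16]
    each, whence the constants 32 and [1760 = 16 * 110]. *)
Lemma reduced_arcs_lower (R : realType) (beta p g g0 n k s N a e e' : R) :
  0 < beta -> beta < 1 / 4 -> 0 < p -> 0 <= g0 -> g0 <= 1 -> g0 <= g ->
  0 < N -> 1760 <= beta * N -> 32 <= beta * n -> 0 < k -> 0 <= s -> k * s <= n -> 0 <= a ->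
  (1 - beta / 2) * p * (n * (n - 1)) <= 2 * e -> 0 <= e ->
  (g + beta) * e <= e' -> 2 * e' <= p * (a * s ^+ 2 + 110 * (n ^+ 2 / N)) ->
  (g0 + beta / 4) * k ^+ 2 <= a.
Proof.
move=> b0 b4 p0 g00 g01 g0g N0 bN bn k0 s0 ksn a0 he e0 he' up.
have n0 : 0 < n by rewrite -(pmulr_rgt0 _ b0); apply: lt_le_trans bn.
have h1 : (g0 + beta) * ((1 - beta / 2) * p * (n * (n - 1))) <= 2 * e'.
  apply: (@le_trans _ _ ((g0 + beta) * (2 * e))).
    by apply: ler_wpM2l; rewrite // addr_ge0 // ltW.
  rewrite mulrCA ler_pM2l //; apply: le_trans he'; apply: ler_wpM2r => //.
  by rewrite lerD2r.
have h2 : (g0 + beta) * (1 - beta / 2) * (n * (n - 1)) <= a * s ^+ 2 + 110 * (n ^+ 2 / N).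
  rewrite -(ler_pM2l p0); apply: le_trans up; apply: le_trans h1.
  by rewrite le_eqVlt; apply/orP; left; apply/eqP; ring.
have n1 : 2 * n <= beta / 16 * n ^+ 2.
  by rewrite expr2 mulrA ler_pM2r //; lra.
have n2 : 110 * (n ^+ 2 / N) <= beta / 16 * n ^+ 2.
  rewrite mulrCA mulrC; apply: ler_wpM2r; first by rewrite exprn_ge0 // ltW.
  by rewrite ler_pdivrMr //; lra.
have c1 : g0 + 3 * beta / 8 <= (g0 + beta) * (1 - beta / 2) by nra.
have c2 : (g0 + beta) * (1 - beta / 2) <= 2 by nra.
have h3 : (g0 + beta / 4) * n ^+ 2 <= a * s ^+ 2.
  have : (g0 + 3 * beta / 8) * n ^+ 2 <= (g0 + beta) * (1 - beta / 2) * n ^+ 2.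
    by apply: ler_wpM2r; rewrite ?exprn_ge0 // ltW.
  have : (g0 + beta) * (1 - beta / 2) * n <= 2 * n by rewrite ler_pM2r.
  by move: h2 n1 n2; set c := (g0 + beta) * (1 - beta / 2); set u := n ^+ 2 / N; clear; rewrite !expr2; lra.
have n20 : 0 < n ^+ 2 by rewrite exprn_gt0.
rewrite -(ler_pM2r n20) mulrAC.
apply: (@le_trans _ _ (a * s ^+ 2 * k ^+ 2)).
  by apply: ler_wpM2r => //; rewrite exprn_ge0 // ltW.
rewrite -mulrA; apply: ler_wpM2l => //; rewrite -exprMn mulrC ler_sqr // nnegrE.
  by rewrite mulr_ge0 // ltW.
exact: ltW.
Qed.

(** * Lower bounds for [g] and matchings of prescribed relative size *)

Lemma bin2_natr (R : realType) (n : nat) : 2 * 'C(n, 2)%:R = n%:R * (n%:R - 1) :> R.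
Proof.
rewrite -natrM mulnC -[X in (_ * X)%N]/(2`!) bin_ffact ffactnS ffactn1 natrM.
by case: n => [|n]; rewrite ?mul0r // -natr1 addrK.
Qed.

Lemma natr_divn_lt (R : realType) (a b : nat) : (0 < b)%N ->
  a%:R <= b%:R * (a %/ b + 1)%:R :> R.
Proof. by move=> b0; rewrite -natrM ler_nat mulnC addn1 ltnW // ltn_ceil. Qed.

Lemma g_ge (R : realType) (gamma x : R) (t n : nat) : (2 <= n)%N ->
  x * (n%:R * (n%:R - 1)) <= 2 * (g_edges gamma t n)%:R -> x <= g gamma t n.
Proof.
move=> n2 H; rewrite /g ler_pdivlMr ?ltr0n ?bin_gt0 // -(ler_pM2l (ltr0n _ 2)).
by rewrite mulrCA bin2_natr.
Qed.

(** Two cliques of orders [t - 1] and [n - t + 2] sharing a vertex have asymptotic density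
    [tau ^ 2 + (1 - tau) ^ 2] with [tau = t / n], the shape of the threshold in
    [very_dense_component_matching]; [3 / n] absorbs the lower order terms. *)
Lemma g_ge_long (R : realType) (gamma : R) (t n : nat) : (2 <= n)%N ->
  (n + 3 <= 2 * t)%N -> (t <= n)%N ->
  (t%:R / n%:R) ^+ 2 + (1 - t%:R / n%:R) ^+ 2 - 3 / n%:R <= g gamma t n.
Proof.
move=> n2 nt tn; apply: g_ge => //; rewrite /g_edges nt.
have t1 : (1 <= t)%N by move: nt n2; clear; lia.
have -> : 2 * ('C(t - 1, 2) + 'C(n + 2 - t, 2) + 1)%:R =
    (t%:R - 1) * (t%:R - 1 - 1) + (n%:R + 2 - t%:R) * (n%:R + 2 - t%:R - 1) + 2 :> R.
  rewrite !natrD 2!mulrDr !bin2_natr mulr1 natrB // natrB ?natrD //.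
  by apply: leq_trans tn _; apply: leq_addr.
have n0 : 0 < n%:R :> R by rewrite ltr0n; move: n2; clear; lia.
have n1 : 1 <= n%:R :> R by rewrite ler1n; move: n2; clear; lia.
have tn' : t%:R <= n%:R :> R by rewrite ler_nat.
have t0 : 0 <= t%:R :> R by [].
move: (n%:R : R) (t%:R : R) n0 n1 tn' t0 => x y x0 x1 yx y0; clear -x0 x1 yx y0.
have -> : ((y / x) ^+ 2 + (1 - y / x) ^+ 2 - 3 / x) * (x * (x - 1)) =
    (y ^+ 2 + (x - y) ^+ 2 - 3 * x) * (1 - 1 / x) by field; apply: lt0r_neq0.
apply: (@le_trans _ _ (y ^+ 2 + (x - y) ^+ 2 - 3 * y + 3 * (x - y) + 6)); last by lra.
have u1 : 0 <= 1 / x by rewrite divr_ge0 // ltW.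
have u2 : 1 / x <= 1 by rewrite ler_pdivrMr // mul1r.
have e : (x * (1 / x)) = 1 by rewrite mulrCA mulfV ?mulr1 //; apply: lt0r_neq0.
have s0 : 0 <= y ^+ 2 + (x - y) ^+ 2 by rewrite addr_ge0 // sqr_ge0.
have : 0 <= (1 / x) * (y ^+ 2 + (x - y) ^+ 2) by rewrite mulr_ge0.
by move: e; set u := 1 / x; set w := y ^+ 2 + (x - y) ^+ 2; move=> e h; nra.
Qed.

Lemma g_ge_odd (R : realType) (gamma : R) (t n : nat) : (2 <= n)%N -> odd t ->
  ~~ (n + 3 <= 2 * t)%N -> 1 / 2 <= g gamma t n.
Proof.
move=> n2 ot nt; apply: g_ge => //; rewrite /g_edges (negbTE nt) ot.
have := @natr_divn_lt R (n ^ 2) 4 isT; rewrite -mulnn natrM.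
have : 0 <= n%:R :> R by []; move: (n%:R : R) (_%:R : R) => x y; nra.
Qed.

Lemma g_ge_even (R : realType) (gamma : R) (t n : nat) : (2 <= n)%N -> ~~ odd t ->
  ~~ (n + 3 <= 2 * t)%N -> gamma * n%:R <= t%:R -> (1 <= t)%N ->
  (t%:R - 1) / n%:R <= g gamma t n.
Proof.
move=> n2 ot nt gt t1; apply: g_ge => //; rewrite /g_edges (negbTE nt) (negbTE ot) gt.
have := @natr_divn_lt R (n * (t - 1)) 2 isT; rewrite natrM natrB // mulr1n.
have n0 : 0 < n%:R :> R by rewrite ltr0n; move: n2; clear; lia.
have t0 : 1 <= t%:R :> R by rewrite ler1n.
apply: le_trans; rewrite mulrA divfK ?lt0r_neq0 // mulrC.
by apply: ler_wpM2r; [rewrite subr_ge0 | rewrite lerBlDr lerDl].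
Qed.

Lemma g_ge0 (R : realType) (gamma : R) (t n : nat) : 0 <= g gamma t n.
Proof. by rewrite /g divr_ge0. Qed.

Lemma dense_component (R : realType) (I : finType) (r : rel I) (P : {set I}) (x : R) :
  symmetric r -> support_in r P -> 0 <= x -> x * #|P|%:R ^+ 2 < #|[set z | r z.1 z.2]|%:R ->
  exists v Q, [/\ v \in P, component_matching r v Q, x * #|P|%:R <= Q%:R &
                  Q%:R <= x * #|P|%:R + 1].
Proof.
move=> rs rP x0 big; have y0 : 0 <= x * #|P|%:R by rewrite mulr_ge0.
have /andP[t1 t2] := Num.Theory.truncn_itv y0.
set Q := Num.truncn (x * #|P|%:R) in t1 t2.
have [|v vP cm] := @dense_component_matching _ r P Q rs rP.
  rewrite -(ltr_nat R) natrM; apply: le_lt_trans big; rewrite expr2 mulrA.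
  exact: ler_wpM2r.
by exists v, Q.+1; split=> //; [exact: ltW | rewrite -natr1 lerD2r].
Qed.

(** The margin 2 keeps the rounded value [Q] of [x * #|P|] above half of [#|P|], where
    [y ^ 2 + (#|P| - y) ^ 2] is increasing in [y], so that rounding down is harmless. *)
Lemma very_dense_component (R : realType) (I : finType) (r : rel I) (P : {set I}) (x : R) :
  symmetric r -> support_in r P -> x <= 1 -> #|P|%:R + 2 <= 2 * (x * #|P|%:R) ->
  (x ^+ 2 + (1 - x) ^+ 2) * #|P|%:R ^+ 2 < #|[set z | r z.1 z.2]|%:R ->
  exists v Q, [/\ v \in P, component_matching r v Q, x * #|P|%:R <= Q%:R,
    Q%:R <= x * #|P|%:R + 1 & connect (parity_rel r) (v, false) (v, true)].
Proof.
move=> rs rP x1 xk big.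
have k0 : 0 <= #|P|%:R :> R by [].
have y0 : 0 <= x * #|P|%:R by lra.
have /andP[t1 t2] := Num.Theory.truncn_itv y0.
set Q := Num.truncn (x * #|P|%:R) in t1 t2; rewrite -natr1 in t2.
have QP' : Q%:R <= #|P|%:R :> R by apply: le_trans t1 _; rewrite ler_piMl.
have QP : (Q <= #|P|)%N by rewrite -(ler_nat R).
have [||v [vP cm con]] := @very_dense_component_matching _ r P Q rs rP QP.
- by rewrite -(ler_nat R) natrM; lra.
- rewrite -(ltr_nat R) natrD !natrM natrB //; apply: le_lt_trans big.
  move: (Q%:R : R) (#|P|%:R : R) k0 t1 t2 xk QP' => q k k0 t1 t2 xk qk.
  have -> : (x ^+ 2 + (1 - x) ^+ 2) * k ^+ 2 = (x * k) ^+ 2 + (k - x * k) ^+ 2 by ring.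
  by move: (x * k) t1 t2 xk => y t1 t2 xk; nra.
by exists v, Q.+1; split=> //; [rewrite -natr1; exact: ltW | rewrite -natr1 lerD2r].
Qed.

(** [N] is chosen so that, with [m] about [s / N], the overhead in a block is at most
    [s / (100 * D)], a fraction of at most [beta / 100] once [1 <= beta * D]. *)
Lemma capacity_bound (D K N n k s : nat) :
  N = (2000 * (D * (8 * D + 40)))%N -> (2 <= D)%N -> (k <= K)%N -> (N <= k)%N ->
  (k * s <= n)%N -> (N * (n - k * s) <= n)%N ->
  (2 * K * (800 * (D * (K * K)) + N) <= n)%N ->
  (100 * (D * ((8 * D + 40) * (s %/ N).+1 + 4 * (K * K))) <= s)%N /\ (n <= 2 * K * s)%N.
Proof.
move=> NE D2 kK Nk ksn lo big.
have N1 : (2 <= N)%N by rewrite NE; move: D2; clear; nia.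
have n2 : (n <= 2 * (k * s))%N.
  have : (2 * (n - k * s) <= N * (n - k * s))%N by rewrite leq_mul2r N1 orbT.
  by move: lo ksn; clear; move: (k * s)%N; lia.
have nKs : (n <= 2 * K * s)%N.
  by apply: leq_trans n2 _; rewrite -mulnA leq_mul2l /= leq_mul2r kK orbT.
split=> //.
have K0 : (0 < 2 * K)%N by move: N1 Nk kK; clear; lia.
have sb : (800 * (D * (K * K)) + N <= s)%N by rewrite -(leq_pmul2l K0); apply: leq_trans nKs.
have mN : ((s %/ N).+1 * N <= s + N)%N by rewrite mulSnr leq_add2r leq_trunc_div.
move: mN sb; rewrite {2 3 4}NE; clear.
move: (s %/ N).+1 (K * K)%N => m c; nia.
Qed.

(** Overhead in the blocks and uncovered vertices reduce the capacity to [x * (1 - beta / 100) * (1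
    - beta / 2000) * n], which is at least [(x - beta / 50) * n]. The gap between [beta / 50] and
    [beta / 32] amounts to more than 1 vertex, because [beta * n >= 100]. *)
Lemma cycle_from_matching (R : realType) (T : finType) (G : sgraph T) (P : {set {set T}})
    (s D K N Q t : nat) (v : {set T}) (beta x : R) :
  N = (2000 * (D * (8 * D + 40)))%N -> (2 <= D)%N -> 0 < beta -> beta < 1 / 4 -> 1 <= beta * D%:R ->
  equiblocks P s -> (N <= #|P|)%N -> (#|P| <= K)%N -> (N * (#|T| - #|P| * s) <= #|T|)%N ->
  (2 * K * (800 * (D * (K * K)) + N) <= #|T|)%N -> (8 * (16 * (K * K) * (16 * (K * K))) <= #|T|)%N ->
  (8 * (K * K) * (2 * K + 4) <= #|T|)%N -> 100 <= beta * #|T|%:R ->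
  v \in P -> component_matching (reduced G (s %/ N).+1 P) v Q ->
  (odd t -> connect (parity_rel (reduced G (s %/ N).+1 P)) (v, false) (v, true)) ->
  0 < x -> x <= 1 - beta / 2 -> x * #|P|%:R <= Q%:R -> Q%:R <= x * #|P|%:R + 1 ->
  t%:R <= (x - beta / 32) * #|T|%:R + 1 ->
  (2 * up_log D (s %/ N).+1 + 2 * K + 4 <= t)%N -> has_cycle G t.
Proof.
move=> NE D2 b0 b4 bD eP NP PK lo n1 n2 n3 bn vP cm par x0 xb Qlo Qhi tx tlo.
have ksn : (#|P| * s <= #|T|)%N by rewrite -(card_equiblocks eP) max_card.
have [cap nKs] := capacity_bound NE D2 PK NP ksn lo n1.
set m := (s %/ N).+1 in cap cm par tlo.
have D0 : (0 < D)%N by apply: leq_trans D2.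
have K0 : (0 < K)%N by move: NP PK; rewrite NE; move: D2; clear; nia.
pose L := (s - ((8 * D + 40) * m + 4 * (K * K)))%N.
have Lle : (100 * ((8 * D + 40) * m + 4 * (K * K)) <= s)%N.
  by apply: leq_trans cap; rewrite leq_mul2l /= leq_pmull.
have LE : (L + (8 * D + 40) * m + 4 * (K * K) = s)%N.
  by rewrite /L -addnA subnK //; move: Lle; clear; lia.
have ms : (m <= #|T|)%N.
  have k0 : (0 < #|P|)%N by rewrite lt0n cards_eq0; apply/set0Pn; exists v.
  apply: leq_trans ksn; apply: leq_trans (_ : s <= _)%N; last by rewrite leq_pmull.
  apply: leq_trans Lle; apply: leq_trans (_ : (8 * D + 40) * m <= _)%N; first by rewrite leq_pmull // addn_gt0 orbT.
  by clear; lia.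
have k0 : 0 < #|P|%:R :> R by rewrite ltr0n lt0n cards_eq0; apply/set0Pn; exists v.
have Nb : 2000 <= beta * N%:R.
  rewrite NE !natrM mulrCA -[X in X <= _]mulr1 ler_pM2l // mulrA.
  rewrite -[X in X <= _](mulr1 1); apply: ler_pM => //; rewrite ler1n addn_gt0 orbT //.
have bk : 2000 <= beta * #|P|%:R.
  by apply: le_trans Nb _; rewrite ler_pM2l // ler_nat.
apply: (@cycle_up_to_capacity _ G P s m D K Q L t v) => //.
- by rewrite -(ltr_nat R); apply: lt_le_trans Qlo; rewrite mulr_gt0.
- rewrite -(ler_nat R); apply: le_trans Qhi _.
  have : x * #|P|%:R <= (1 - beta / 2) * #|P|%:R by rewrite ler_pM2r.
  by move: bk; clear; lra.
- by rewrite LE.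
- have up := @up_log_small D m #|T| (16 * (K * K)) D2 isT ms n2.
  have L2 : (s <= 2 * L)%N by move: LE Lle; rewrite -addnA; clear; lia.
  rewrite -(leq_pmul2l (isT : (0 < 2)%N)); apply: leq_trans L2.
  have K2 : (0 < 2 * K)%N by rewrite muln_gt0.
  rewrite -(leq_pmul2l K2); apply: leq_trans nKs.
  rewrite (_ : (2 * K * (2 * (K * (2 * up_log D m + 2 * K + 4))) =
    8 * (K * K) * up_log D m + 4 * (K * K) * (2 * K + 4))%N); last by clear; lia.
  move: up n3; rewrite -!(mulnA _ (K * K)%N).
  by move: (_ * up_log D m)%N (_ * (2 * K + 4))%N; clear; lia.
have XE : ((8 * D + 40) * m + 4 * (K * K))%:R <= beta * s%:R / 100 :> R.
  rewrite ler_pdivlMr // mulrC.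
  have : 100 * (D%:R * ((8 * D + 40) * m + 4 * (K * K))%:R) <= s%:R :> R by rewrite -!natrM ler_nat.
  rewrite -(ler_pM2l b0); apply: le_trans; rewrite mulrCA ler_pM2l // mulrA.
  by apply: ler_peMl.
have Lr : (1 - beta / 100) * s%:R <= L%:R :> R.
  have : s%:R = L%:R + ((8 * D + 40) * m + 4 * (K * K))%:R :> R by rewrite -natrD addnA LE.
  by move: XE; clear; lra.
have ks : (1 - beta / 2000) * #|T|%:R <= #|P|%:R * s%:R :> R.
  have : N%:R * (#|T|%:R - #|P|%:R * s%:R) <= #|T|%:R :> R.
    by rewrite -natrM -natrB // -natrM ler_nat.
  rewrite -(ler_pM2l b0) mulrA => h.
  have : 2000 * (#|T|%:R - #|P|%:R * s%:R) <= beta * #|T|%:R :> R.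
    apply: le_trans h; apply: ler_wpM2r => //.
    by rewrite subr_ge0 -natrM ler_nat.
  by clear; lra.
have bb : 0 <= 1 - beta / 100 by move: b4; clear; lra.
rewrite -(ler_nat R) natrM; apply: le_trans tx _.
apply: (@le_trans _ _ (x * #|P|%:R * ((1 - beta / 100) * s%:R))); last first.
  by apply: ler_pM => //; apply: mulr_ge0 => //; apply: ltW.
have e1 : (x * (1 - beta / 100)) * ((1 - beta / 2000) * #|T|%:R) <=
    (x * (1 - beta / 100)) * (#|P|%:R * s%:R).
  by apply: ler_wpM2l => //; apply: mulr_ge0 => //; apply: ltW.
rewrite (_ : x * #|P|%:R * ((1 - beta / 100) * s%:R) =
  (x * (1 - beta / 100)) * (#|P|%:R * s%:R)); last by ring.
apply: le_trans e1.
have n0 : 0 <= #|T|%:R :> R by [].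
have xn : x * (1 - (1 - beta / 100) * (1 - beta / 2000)) <= beta / 50.
  have : 1 - (1 - beta / 100) * (1 - beta / 2000) <= beta / 50 by nra.
  move=> h; apply: le_trans h; apply: ler_piMl; first by nra.
  by move: xb b0; clear; lra.
have := ler_wpM2r n0 xn; move: bn; move: (#|T|%:R : R) => n; clear; lra.
Qed.

(** From [D ^ d.-1 <= n] and [1 / beta <= D] follows [d - 1 <= ln n / ln (1 / beta)]. The two trees
    need twice this, and a third copy absorbs the constants once [D ^ (2 * K + 6) <= n]: hence the
    factor 3. *)
Lemma up_log_le_ln (R : realType) (beta : R) (D K m n t : nat) :
  (2 <= D)%N -> 0 < beta -> beta < 1 -> 1 / beta <= D%:R -> (0 < m)%N -> (m <= n)%N ->
  (D ^ (2 * K + 6) <= n)%N -> 3 / ln (1 / beta) * ln n%:R <= t%:R ->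
  (2 * up_log D m + 2 * K + 4 <= t)%N.
Proof.
move=> D2 b0 b1 bD m0 mn Dn; set d := up_log D m.
have D0 : (0 < D)%N by apply: leq_trans D2.
have n0 : 0 < n%:R :> R by rewrite ltr0n; apply: leq_trans mn.
have Dm : (D ^ d.-1 <= n)%N.
  apply: leq_trans mn; case: (leqP m 1) => m1; last by have /andP[/ltnW] := up_log_bounds D2 m1.
  by rewrite /d (_ : m = 1%N) ?up_log1 //; apply/eqP; rewrite eqn_leq m1.
set la := ln (1 / beta).
have la0 : 0 < la by rewrite ln_gt0 // ltr_pdivlMr // mul1r.
have pow e : (D ^ e <= n)%N -> e%:R * la <= ln n%:R.
  move=> en; apply: (@le_trans _ _ (ln (D ^ e)%:R)); last first.
    by rewrite ler_ln ?ler_nat // posrE // ltr0n expn_gt0 D0.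
  rewrite natrX lnXn ?ltr0n // -[leRHS]mulr_natl; apply: ler_wpM2l => //.
  by rewrite ler_ln // posrE ?ltr0n // divr_gt0.
move=> tlo; rewrite -(ler_nat R); apply: le_trans tlo.
rewrite mulrAC ler_pdivlMr //.
have h1 := pow _ Dm; have h2 := pow _ Dn.
have dd : (2 * d + 2 * K + 4)%:R <= 2 * (d.-1)%:R + (2 * K + 6)%:R :> R.
  by rewrite -natrM -natrD ler_nat; case: (d) => [|d'] /=; clear; lia.
have := ler_wpM2r (ltW la0) dd; rewrite mulrDl.
by move: h1 h2; clear; lra.
Qed.

Theorem theorem1p4 (R : realType) :
  exists C1 C2 : R, 0 < C1 /\ 0 < C2 /\
  forall beta : R, 0 < beta -> beta < 1 / 4 ->
  exists (eta : R) (n0 : nat) (gamma : R),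
    0 < eta /\ eta <= 1 /\ (0 < n0)%N /\ 0 < gamma /\
    forall n : nat, (n0 <= n)%N ->
    forall (T : finType) (G : sgraph T) (p : R),
      #|T| = n -> 0 < p -> p <= 1 ->
      upper_uniform p eta G ->
      (1 - beta / 2) * p * 'C(n, 2)%:R <= (nb_edges G)%:R ->
      forall t : nat,
        C1 / ln (1 / beta) * ln n%:R <= t%:R ->
        t%:R <= (1 - C2 * beta) * n%:R ->
        forall G' : sgraph T, subgraph G' G ->
          (g gamma t n + beta) * (nb_edges G)%:R <= (nb_edges G')%:R ->
          has_cycle G' t.
Proof.
(* The 3 is that of [up_log_le_ln]; the 4 leaves room for the margin [x <= 1 - beta / 2] of the
   matched fraction. *)
exists 3, 4; split; [by []|split; [by []|]] => beta b0 b4.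
pose D := Num.bound (1 / beta).
have bD : 1 / beta < D%:R by apply: archi_boundP; rewrite divr_ge0 // ltW.
have bD1 : 1 <= beta * D%:R by move: bD; rewrite ltr_pdivrMr // mulrC => /ltW.
have D2 : (2 <= D)%N.
  rewrite -(ler_nat R); apply: le_trans (ltW bD); rewrite ler_pdivlMr //.
  by move: b4; clear; lra.
pose N := (2000 * (D * (8 * D + 40)))%N.
have N8 : (8 <= N)%N by rewrite /N; move: D2; clear; nia.
have N2 : (2 <= N)%N by apply: leq_trans N8.
have N0 : (0 < N)%N by apply: leq_trans N8.
have Nb : 2000 <= beta * N%:R.
  rewrite /N !natrM mulrCA -[X in X <= _]mulr1 ler_pM2l // mulrA.
  rewrite -[X in X <= _](mulr1 1); apply: ler_pM => //; rewrite ler1n addn_gt0 orbT //.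
have [K [n1 reg]] := regular_blocks N2 N0.
pose n0 := (n1 + D ^ (2 * K + 6) + 2 * K * (800 * (D * (K * K)) + N) +
  8 * (16 * (K * K) * (16 * (K * K))) + 8 * (K * K) * (2 * K + 4) + 100 * D + 2)%N.
(* This [eta] is at most [1 / N], and [eta * n <= s] because [n <= 2 * K * s], so blocks are large
   enough for upper-uniformity. Lengths below [beta / 16 * n] are handled by the surplus [beta]
   alone. *)
exists ((2 * K + N)%:R^-1), n0, (beta / 16).
have KN0 : 0 < (2 * K + N)%:R :> R by rewrite ltr0n addn_gt0 N0 orbT.
split; first by rewrite invr_gt0.
split; first by rewrite invf_le1 // ler1n addn_gt0 N0 orbT.
split; first by rewrite /n0 addn2.
split; first by rewrite divr_gt0.
move=> n nn0 T G p Tn p0 p1 uu eG t tlo thi G' GG eG'.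
have [[nn1 nD nK nKK nKKK] [nb n2]] : [/\ n1 <= n, D ^ (2 * K + 6) <= n,
    2 * K * (800 * (D * (K * K)) + N) <= n, 8 * (16 * (K * K) * (16 * (K * K))) <= n &
    8 * (K * K) * (2 * K + 4) <= n]%N /\ (100 * D <= n /\ 2 <= n)%N.
  split; first split; last split; by apply: leq_trans nn0; rewrite /n0; clear;
    move: (D ^ _)%N (2 * K * _)%N (8 * (16 * _ * _))%N (8 * _ * _)%N; lia.
have bn : 100 <= beta * n%:R.
  apply: (@le_trans _ _ (beta * (100 * D)%:R)); last by rewrite ler_pM2l // ler_nat.
  by rewrite natrM mulrCA; move: bD1; clear; lra.
have nT : (n1 <= #|T|)%N by rewrite Tn.
have [P [s [eP s0 /andP[NP PK] lo irr]]] := reg T G' nT.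
have ksn : (#|P| * s <= n)%N by rewrite -Tn -(card_equiblocks eP) max_card.
rewrite Tn in lo.
have [_ nKs] := capacity_bound (erefl N) D2 PK NP ksn lo nK.
have k0 : (0 < #|P|)%N by apply: leq_trans NP.
pose m := (s %/ N).+1.
have mn : (m <= n)%N.
  apply: leq_trans ksn; apply: leq_trans (_ : s <= _)%N; last by rewrite leq_pmull.
  by rewrite /m ltn_Pdiv.
have b1 : beta < 1 by move: b4; clear; lra.
have tlo' := up_log_le_ln D2 b0 b1 (ltW bD) (isT : 0 < m)%N mn nD tlo.
set r := reduced G' m P.
have rs : symmetric r by apply: reduced_sym.
have rP : support_in r P by apply: reduced_support.
pose a : R := #|[set z | r z.1 z.2]|%:R.
have n0' : 0 < n%:R :> R by rewrite ltr0n; apply: leq_trans n2.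
have k0' : 0 < #|P|%:R :> R by rewrite ltr0n.
have bk : 2000 <= beta * #|P|%:R.
  by apply: le_trans Nb _; rewrite ler_pM2l // ler_nat.
have dens g0 : 0 <= g0 -> g0 <= 1 -> g0 <= g (beta / 16) t n -> (g0 + beta / 4) * #|P|%:R ^+ 2 <= a.
  move=> g00 g01 g0g.
  apply: (@reduced_arcs_lower R beta p (g (beta / 16) t n) g0 n%:R #|P|%:R s%:R N%:R a
            (nb_edges G)%:R (nb_edges G')%:R) => //.
  - by move: Nb; clear; lra.
  - by move: bn; clear; lra.
  - by rewrite -natrM ler_nat.
  - by rewrite -bin2_natr mulrCA ler_pM2l.
  rewrite -natrM -Tn; apply: (reduced_density p0 _ uu GG N8) => //.
  - by rewrite invr_gt0.
  - by rewrite ler_pdivrMr // mul1r ler_nat leq_addl.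
  - rewrite mulrC ler_pdivrMr // -natrM ler_nat Tn mulnC; apply: leq_trans nKs _.
    by rewrite leq_mul2r leq_addr orbT.
  - by rewrite Tn.
have fin v Q x : v \in P -> component_matching r v Q ->
    (odd t -> connect (parity_rel r) (v, false) (v, true)) -> 0 < x -> x <= 1 - beta / 2 ->
    x * #|P|%:R <= Q%:R -> Q%:R <= x * #|P|%:R + 1 ->
    t%:R <= (x - beta / 32) * n%:R + 1 -> has_cycle G' t.
  move=> vP cm par x0 xb Ql Qh tx.
  by apply: (@cycle_from_matching R T G' P s D K N Q t v beta x); rewrite ?Tn.
pose tau : R := t%:R / n%:R.
have tauE : t%:R = tau * n%:R by rewrite divfK // lt0r_neq0.
have tau0 : 0 <= tau by rewrite divr_ge0.
have tau1 : tau <= 1 - 4 * beta by rewrite ler_pdivrMr.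
have in1 : 1 / n%:R <= beta / 100.
  by rewrite ler_pdivrMr //; move: bn; clear; lra.
have in0 : 0 <= 1 / n%:R :> R by rewrite divr_ge0.
have k20 : 0 < #|P|%:R ^+ 2 :> R by rewrite exprn_gt0.
(* Below [gamma * n] the ratio [tau] is under [beta / 16] and [g0 = 0] will do; otherwise
   [g0 = (t - 1) / n]. Either way the fraction [tau + beta / 32] is less than the density
   [g0 + beta / 4]. *)
have even_short : ~~ odd t -> ~~ (n + 3 <= 2 * t)%N -> has_cycle G' t.
  move=> et st.
  have [g0 [g00 g01 g0g tg]] : exists g0, [/\ 0 <= g0, g0 <= 1, g0 <= g (beta / 16) t n &
      tau <= g0 + beta / 16].
    case: (boolP (beta / 16 * n%:R <= t%:R)) => gt.
      have t1 : (1 <= t)%N by move: tlo'; clear; lia.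
      exists ((t%:R - 1) / n%:R); split.
      - by rewrite divr_ge0 // subr_ge0 ler1n.
      - by move: in0 tau1 b0; rewrite mulrBl -/tau; clear; lra.
      - exact: g_ge_even.
      - by move: in1 b0; rewrite mulrBl -/tau; clear; lra.
    exists 0; split=> //; first exact: g_ge0.
    by rewrite add0r ler_pdivrMr // ltW // ltNge.
  have [||v [Q [vP cm Ql Qh]]] := @dense_component R _ r P (tau + beta / 32) rs rP.
  - by move: tau0 b0; clear; lra.
  - apply: lt_le_trans (dens g0 g00 g01 g0g); rewrite ltr_pM2r //.
    by move: tg b0; clear; lra.
  apply: (fin v Q (tau + beta / 32)) => //.
  - by rewrite (negbTE et).
  - by move: tau0 b0; clear; lra.
  - by move: tau1 b0; clear; lra.
  - by rewrite addrK -tauE lerDl.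
(* Enlarging [y] by [beta / 32] raises [y ^ 2 + (1 - y) ^ 2] by little more than [beta / 16], and
   [3 / n] is at most [3 * beta / 100]; both fit into the surplus [beta / 4]. *)
have long y g0 : 1 / 2 <= y -> y <= 1 - beta -> t%:R <= y * n%:R + 1 ->
    0 <= g0 -> g0 <= 1 -> g0 <= g (beta / 16) t n ->
    y ^+ 2 + (1 - y) ^+ 2 - 3 / n%:R <= g0 -> has_cycle G' t.
  move=> y1 y2 ty g00 g01 g0g yg.
  have [|||v [Q [vP cm Ql Qh con]]] := @very_dense_component R _ r P (y + beta / 32) rs rP.
  - by move: y2 b0; clear; lra.
  - have := ler_wpM2r (ltW k0') y1; move: bk; clear; lra.
  - apply: lt_le_trans (dens g0 g00 g01 g0g); rewrite ltr_pM2r //.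
    have i3 : 3 / n%:R <= 3 * beta / 100.
      by move: in1; rewrite -(ler_pM2l (ltr0n R 3)); clear; lra.
    by move: y1 y2 yg i3 b0 b4; move: (3 / n%:R) => u; clear; nra.
  apply: (fin v Q (y + beta / 32)) => //.
  - by move: y1 b0; clear; lra.
  - by move: y2 b0; clear; lra.
  - by rewrite addrK.
case: (boolP (n + 3 <= 2 * t)%N) => nt.
  have tn : (t <= n)%N.
    rewrite -(ler_nat R) tauE -[leRHS]mul1r ler_pM2r //.
    by move: tau1 b0; clear; lra.
  have th : 1 / 2 <= tau.
    rewrite ler_pdivlMr // mulrC mulrA mulr1 ler_pdivrMr // -natrM ler_nat.
    by move: nt; clear; lia.
  apply: (long tau (tau ^+ 2 + (1 - tau) ^+ 2 - 3 / n%:R)) => //.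
  - by move: tau1 b0; clear; lra.
  - by rewrite -tauE lerDl.
  - have : 3 * (1 / n%:R) <= 3 * (beta / 100) by rewrite ler_pM2l.
    have : 0 <= (2 * tau - 1) ^+ 2 by apply: sqr_ge0.
    by rewrite mulrA mulr1; move: b4; clear; nra.
  - have : 0 <= 3 / n%:R :> R by rewrite divr_ge0.
    by move: tau0 tau1 b0; clear; nra.
  - exact: g_ge_long.
case: (boolP (odd t)) => ot; last exact: even_short.
(* Here [t <= (n + 2) / 2], so the fraction one half suffices; the excess over [n / 2] is the 1
   allowed in [long]. *)
apply: (long (1 / 2) (1 / 2)) => //.
- by move: b4; clear; lra.
- have : (2 * t)%:R <= (n + 2)%:R :> R by rewrite ler_nat; move: nt; clear; lia.
  by rewrite natrM natrD; clear; lra.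
- by clear; lra.
- by clear; lra.
- exact: g_ge_odd.
- have : 0 <= 3 / n%:R :> R by rewrite divr_ge0.
  by clear; lra.
Qed.
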